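(* Let $\bullet$ be nothing, ''$\le 1$'' or ''$1$''. Identify the monad $\mathbf V_\bullet$ of continuous valuations with the isomorphic monad $\mathbb P_{\mathtt P}^\bullet$ of linear previsions. The maps $r_{\mathtt{DP}}\colon \mathcal Q_{\mathsf V}\mathbf V_\bullet X\to\mathbb P_{\mathtt{DP}}^\bullet X$ and $s_{\mathtt{DP}}^\bullet\colon\mathbb P_{\mathtt{DP}}^\bullet X\to\mathcal Q_{\mathsf V}\mathbf V_\bullet X$ ($X$ ranging over topological spaces) form a distributing retraction of $\mathcal Q_{\mathsf V}\mathbf V_\bullet$ onto $\mathbb P_{\mathtt{DP}}^\bullet$ on the category $\mathbf{Top}$ of topological spaces and continuous maps.
   Context: Compactness does not include any separation axiom. $\mathcal L X$ is the set of lower semicontinuous maps $h\colon X\to[0,\infty]$ with the pointwise ordering. $\uparrow$ denotes upward closure in the specialization preordering ($x\le y$ iff every open neighborhood of $x$ contains $y$); a saturated set is one that is upward closed. Monad $\mathcal Q_{\mathsf V}$: $\mathcal Q_{\mathsf V}X$ is the set of non-empty compact saturated subsets of $X$ with the topology with basic open sets $\Box U=\{Q\mid Q\subseteq U\}$, $U$ open in $X$; $\mathcal Q_{\mathsf V}f(Q)=\uparrow f[Q]$, unit $x\mapsto\uparrow x$, multiplication $\mathcal Q\mapsto\bigcup\mathcal Q$. Monad $\mathbf V_\bullet$: a continuous valuation on $X$ is a map $\nu$ from the open sets of $X$ to $[0,\infty]$ with $\nu(\emptyset)=0$, $\nu(U)+\nu(V)=\nu(U\cup V)+\nu(U\cap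 V)$, monotonic and preserving directed unions. $\mathbf V_\bullet X$ is the space of all continuous valuations (resp. those with $\nu(X)\le1$ if $\bullet$ is ''$\le1$'', $\nu(X)=1$ if $\bullet$ is ''$1$''), with subbasic open sets $\{\nu\mid\nu(U)>r\}$, $U$ open, $r\in\mathbb R_+$. Put $\int_{x\in X} h(x)\,d\nu:=\int_0^\infty\nu(h^{-1}(]t,\infty]))\,dt$ for $h\in\mathcal LX$. $\mathbf V_\bullet f(\nu)(V)=\nu(f^{-1}(V))$, the unit sends $x$ to the Dirac valuation $\delta_x$, the multiplication sends $\xi$ to $U\mapsto\int_{\nu}\nu(U)\,d\xi$. Previsions: a prevision on $X$ is a Scott-continuous map $F\colon\mathcal LX\to[0,\infty]$ with $F(ah)=aF(h)$ for $a\in\mathbb R_+$. It is linear (resp. superlinear) if $F(h+h')=F(h)+F(h')$ (resp. $\ge$) for all $h,h'$; subnormalized (resp. normalized) if $F(\mathbf 1+h)\le1+F(h)$ (resp. $=$) for all $h$. $\mathbb P_{\mathtt P}^\bullet X$ (resp. $\mathbb P_{\mathtt{DP}}^\bullet X$) is the space of linear (resp. superlinear) previsions, subnormalized if $\bullet$ is ''$\le1$'' and normalized if $\bullet$ is ''$1$'', with subbasic open sets $[h>r]=\{F\mid F(h)>r\}$, $h\in\mathcal LX$, $r\in\mathbb R_+$. Both are monads on $\mathbf{Top}$: action on $f\colon X\to Y$: $F\mapsto(h\in\mathcal LY\mapsto F(h\circ f))$; unit: $x\mapsto(h\mapsto h(x))$; multiplication: $\mathcal F\mapsto(h\mapsto\mathcal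 F(F\mapsto F(h)))$. The map $\nu\mapsto(h\mapsto\int h\,d\nu)$ is an isomorphism of monads $\mathbf V_\bullet\cong\mathbb P_{\mathtt P}^\bullet$. $r_{\mathtt{DP}}(Q)(h):=\min_{G\in Q}G(h)$; $s_{\mathtt{DP}}^\bullet(F):=\{G\in\mathbb P_{\mathtt P}^\bullet X\mid G(h)\ge F(h)\ \forall h\in\mathcal LX\}$. A distributing retraction of $ST$ onto $U$ (for monads $S,T,U$ on a category) is a pair of natural transformations $r\colon ST\to U$, $s\colon U\to ST$ with $r\circ s=\mathrm{id}$ such that, with $i:=r\circ S\eta^T$, $j:=r\circ\eta^ST$, $e:=s\circ r$ and $f^{\underline S}:=\mu^S\circ Sf$ (juxtaposition being horizontal composition): $r\circ\eta^S\eta^T=\eta^U$; $r\circ\mu^ST=\mu^U\circ ir$; $r\circ S\mu^T=\mu^U\circ rj$; $e\circ\eta^ST=\eta^ST$; $e\circ S\mu^T=S\mu^T\circ eT$; $e\circ(s\circ\mu^U\circ jU)^{\underline S}=(s\circ\mu^U\circ jU)^{\underline S}\circ eU$. *)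

(* Defs.v *)
From HB Require Import structures.
From mathcomp Require Import all_boot all_order all_algebra finmap.
From mathcomp Require Import ring.
From mathcomp Require Import all_classical all_reals all_analysis.

Set Implicit Arguments.
Unset Strict Implicit.
Unset Printing Implicit Defensive.

Import Order.TTheory GRing.Theory Num.Theory.
Import numFieldNormedType.Exports.

Local Open Scope classical_set_scope.
Local Open Scope ring_scope.

Record category := Category {
  obj :> Type;
  hom : obj -> obj -> Type;
  idc : forall A, hom A A;
  comp : forall A B C, hom B C -> hom A B -> hom A C;
  comp_idl : forall A B (f : hom A B), comp (idc B) f = f;
  comp_idr : forall A B (f : hom A B), comp f (idc A) = f;
  compA : forall A B C D (h : hom C D) (g : hom B C) (f : hom A B),
    comp h (comp g f) = comp (comp h g) f }.

Arguments hom {c}.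
Arguments idc {c} A.
Arguments comp {c A B C}.

Declare Scope cat_scope.
Delimit Scope cat_scope with cat.
Notation "g ∘ f" := (comp g f) (at level 40, left associativity) : cat_scope.
Local Open Scope cat_scope.

Record endofunctor (C : category) := Endofunctor {
  fobj :> C -> C;
  fmap : forall A B, hom A B -> hom (fobj A) (fobj B);
  fmap_id : forall A, fmap (idc A) = idc (fobj A);
  fmap_comp : forall A B D (g : hom B D) (f : hom A B),
    fmap (g ∘ f) = fmap g ∘ fmap f }.

Arguments fmap {C} e {A B}.

Section functors.
Context {C : category}.

Definition fid : endofunctor C :=
  @Endofunctor C (fun A => A) (fun _ _ f => f)
    (fun _ => erefl) (fun _ _ _ _ _ => erefl).

Lemma fcomp_id (F G : endofunctor C) (A : C) :
  fmap F (fmap G (idc A)) = idc (F (G A)).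
Proof. by rewrite !fmap_id. Qed.

Lemma fcomp_comp (F G : endofunctor C) (A B D : C)
    (g : hom B D) (f : hom A B) :
  fmap F (fmap G (g ∘ f)) = fmap F (fmap G g) ∘ fmap F (fmap G f).
Proof. by rewrite !fmap_comp. Qed.

Definition fcomp (F G : endofunctor C) : endofunctor C :=
  @Endofunctor C (fun A => F (G A)) (fun _ _ f => fmap F (fmap G f))
    (fcomp_id F G) (@fcomp_comp F G).

Definition natural (F G : endofunctor C) (t : forall A, hom (F A) (G A)) :=
  forall A B (f : hom A B), t B ∘ fmap F f = fmap G f ∘ t A.

(* The component at A of the horizontal composition t t' : F F' -> G G'; the object maps F' and G' are left
   unbundled so that it applies up to associativity of composition. *)
Definition hcomp (F G : endofunctor C) (F' G' : C -> C)
    (t : forall A, hom (F A) (G A)) (t' : forall A, hom (F' A) (G' A)) (A : C) :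
    hom (F (F' A)) (G (G' A)) :=
  fmap G (t' A) ∘ t (F' A).

End functors.

Arguments fid C : clear implicits.
Arguments hcomp {C F G F' G'} t t' A.

Record monad (C : category) := Monad {
  mfun :> endofunctor C;
  unit : forall A, hom A (mfun A);
  mult : forall A, hom (mfun (mfun A)) (mfun A);
  unit_natural : natural (F := fid C) (G := mfun) unit;
  mult_natural : natural (F := fcomp mfun mfun) (G := mfun) mult;
  mult_unitl : forall A, mult A ∘ unit (mfun A) = idc (mfun A);
  mult_unitr : forall A, mult A ∘ fmap mfun (unit A) = idc (mfun A);
  multA : forall A, mult A ∘ mult (mfun A) = mult A ∘ fmap mfun (mult A) }.

Arguments unit {C} m A.
Arguments mult {C} m A.

(* The extension f^S := mult^S ∘ S f. *)
Definition kleisli (C : category) (S : monad C) (A B : C)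
    (f : hom A (S B)) : hom (S A) (S B) :=
  mult S B ∘ fmap S f.

Section distributing_retraction.
Context {C : category} (S T U : monad C).
Implicit Types (r : forall A, hom (S (T A)) (U A))
  (s : forall A, hom (U A) (S (T A))).

Definition retr_i r (A : C) : hom (S A) (U A) := r A ∘ fmap S (unit T A).

Definition retr_j r (A : C) : hom (T A) (U A) := r A ∘ unit S (T A).

Definition retr_e r s (A : C) : hom (S (T A)) (S (T A)) := s A ∘ r A.

Record distributing_retraction r s : Prop := DistributingRetraction {
  retr_r_natural : natural (F := fcomp S T) (G := U) r;
  retr_s_natural : natural (F := U) (G := fcomp S T) s;
  retr_id : forall A, r A ∘ s A = idc (U A);
  retr_unit : forall A, r A ∘ hcomp (F := fid C) (F' := fid C) (G' := T)
      (unit S) (unit T) A = unit U A;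
  retr_multS : forall A, r A ∘ mult S (T A) =
    mult U A ∘ hcomp (G := U) (retr_i r) r A;
  retr_multT : forall A, r A ∘ fmap S (mult T A) =
    mult U A ∘ hcomp (F := fcomp S T) (G := U) r (retr_j r) A;
  retr_e_unitS : forall A, retr_e r s A ∘ unit S (T A) = unit S (T A);
  retr_e_multT : forall A, retr_e r s A ∘ fmap S (mult T A) =
    fmap S (mult T A) ∘ retr_e r s (T A);
  retr_e_kleisli : forall A,
    let f := s A ∘ mult U A ∘ retr_j r (U A) in
    retr_e r s A ∘ kleisli f = kleisli f ∘ retr_e r s (U A) }.

End distributing_retraction.

Section Top.
Implicit Types X Y Z W : topologicalType.

Definition ctsid X : continuousType X X := @idfun X.

Definition ctscomp X Y Z (g : continuousType Y Z) (f : continuousType X Y) :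
  continuousType X Z := g \o f.

Lemma ctscomp_idl X Y (f : continuousType X Y) : ctscomp (ctsid Y) f = f.
Proof. exact/continuousEP. Qed.

Lemma ctscomp_idr X Y (f : continuousType X Y) : ctscomp f (ctsid X) = f.
Proof. exact/continuousEP. Qed.

Lemma ctscompA X Y Z W (h : continuousType Z W) (g : continuousType Y Z)
  (f : continuousType X Y) :
  ctscomp h (ctscomp g f) = ctscomp (ctscomp h g) f.
Proof. exact/continuousEP. Qed.

Definition Top : category :=
  @Category topologicalType (fun X Y => continuousType X Y)
    ctsid ctscomp ctscomp_idl ctscomp_idr ctscompA.

End Top.

Section topological_facts.
Context {X : topologicalType}.

(* The specialization preordering, in the direction for which open sets are
   upward closed. *)
Definition spec_le (x y : X) := forall U : set X, open U -> U x -> U y.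

Definition up (A : set X) : set X := [set y | exists2 x, A x & spec_le x y].

Definition saturated (A : set X) := up A `<=` A.

Lemma spec_refl (x : X) : spec_le x x. Proof. by []. Qed.

Lemma spec_trans (x y z : X) : spec_le x y -> spec_le y z -> spec_le x z.
Proof. by move=> xy yz U oU Ux; apply: (yz U oU); exact: xy. Qed.

Lemma sub_up (A : set X) : A `<=` up A.
Proof. by move=> x Ax; exists x. Qed.

Lemma up_sub_open (A U : set X) : open U -> A `<=` U -> up A `<=` U.
Proof. by move=> oU AU y [x /AU Ux]; apply. Qed.

Lemma saturated_up (A : set X) : saturated (up A).
Proof. by move=> z [y [x Ax xy] yz]; exists x => //; exact: spec_trans yz. Qed.

Lemma saturatedE (A : set X) : saturated A -> up A = A.
Proof. by move=> sA; apply/seteqP; split => //; exact: sub_up. Qed.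

(* The library's [compact_cover] is stated for pointed spaces only, whereas
   the spaces considered here may be empty. *)
Lemma compact_directedP (A : set X) : compact A <->
  forall D : set (set X), D !=set0 -> (forall U, D U -> open U) ->
  (forall U V, D U -> D V -> exists2 W, D W & U `|` V `<=` W) ->
  A `<=` \bigcup_(U in D) U -> exists2 U, D U & A `<=` U.
Proof.
split=> [cA D [U0 DU0] oD dD AD|cA F PF FA].
  apply: contrapT => nD.
  pose F := filter_from D (fun U => A `\` U).
  have FF : ProperFilter F.
    apply: filter_from_proper.
      apply: filter_from_filter; first by exists U0.
      move=> U V DU DV; have [W DW UVW] := dD _ _ DU DV; exists W => //.
      by move=> x [Ax nWx]; split; split => // ?; apply: nWx; apply: UVW;
        [left|right].
    move=> U DU; apply: contrapT => nU; apply: nD; exists U => // x Ax.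
    by apply: contrapT => nUx; apply: nU; exists x.
  have [|x [Ax clx]] := cA F FF; first by exists U0 => // x [].
  have [U DU Ux] := AD _ Ax.
  have [|y [[_ nUy]]] := clx (A `\` U) U _ (open_nbhs_nbhs (conj (oD _ DU) Ux)).
    by exists U.
  by [].
apply: contrapT => nAF.
pose D := [set U : set X | open U /\ exists2 B, F B & U `&` B = set0].
have [||||U [_ [B FB UB]] AU] := cA D.
- by exists set0; split; [exact: open0|exists A; rewrite // set0I].
- by move=> U [].
- move=> U V [oU [B FB UB]] [oV [B' FB' VB]]; exists (U `|` V) => //.
  split; first exact: openU.
  exists (B `&` B'); first exact: filterI.
  apply/seteqP; split=> // x [[Ux|Vx] [Bx B'x]].
    by rewrite -UB; split.
  by rewrite -VB; split.
- move=> x Ax; apply: contrapT => nx; apply: nAF; exists x; split => // B V FB.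
  rewrite nbhsE => -[U [oU Ux] UV]; apply: contrapT => nBV; apply: nx.
  exists U => //; split => //; exists B => //.
  by apply/seteqP; split => // y [Uy By]; apply: nBV; exists y; split => //; exact: UV.
- have /filter_ex[x [Ax Bx]] : F (A `&` B) by exact: filterI.
  by have : (U `&` B) x by [split => //; exact: AU]; rewrite UB.
Qed.

Lemma compact_up (A : set X) : compact A -> compact (up A).
Proof.
move=> /compact_directedP cA; apply/compact_directedP => D D0 oD dD AD.
have [|U DU AU] := cA D D0 oD dD; first by move=> x /sub_up /AD.
by exists U => //; exact: up_sub_open (oD _ DU) AU.
Qed.

End topological_facts.

Lemma open_cts {X Y : topologicalType} (f : continuousType X Y) (U : set Y) :
  open U -> open (f @^-1` U).
Proof.
have fc : continuous f by exact: cts_fun.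
exact: (proj1 (continuousP f) fc).
Qed.

Section smyth.
Context {X : topologicalType}.

Record smyth := Smyth {
  smyth_set :> set X;
  smyth_neq0 : smyth_set !=set0;
  smyth_compact : compact smyth_set;
  smyth_saturated : saturated smyth_set }.

Lemma smythP (Q Q' : smyth) : smyth_set Q = Q' -> Q = Q'.
Proof.
case: Q Q' => [A ? ? ?] [B ? ? ?] /= AB; subst B.
by congr Smyth; exact: Prop_irrelevance.
Qed.

HB.instance Definition _ := gen_eqMixin smyth.
HB.instance Definition _ := gen_choiceMixin smyth.

Definition box (U : set X) : set smyth := [set Q | Q `<=` U].

Lemma box_cover : \bigcup_(U in open) box U = setT.
Proof. by apply/seteqP; split => // Q _; exists setT => //; exact: openT. Qed.

Lemma box_join (U V : set X) (Q : smyth) :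
  open U -> open V -> box U Q -> box V Q ->
  exists W, [/\ open W, box W Q & box W `<=` box U `&` box V].
Proof.
move=> oU oV QU QV; exists (U `&` V); split; first exact: openI.
  by move=> x Qx; split; [exact: QU|exact: QV].
by move=> Q' QUV; split=> x /QUV[].
Qed.

HB.instance Definition _ := isBaseTopological.Build smyth box_cover box_join.

Lemma open_box (U : set X) : open U -> open (box U).
Proof.
move=> oU; exists [set U]; first by move=> _ ->.
by rewrite bigcup_set1.
Qed.

End smyth.
Arguments smyth : clear implicits.

Lemma cts_smyth (X Y : topologicalType) (f : Y -> smyth X) :
  (forall U, open U -> open (f @^-1` box U)) -> continuous f.
Proof.
move=> fU; apply/continuousP => A [D sD <-].
by rewrite preimage_bigcup; apply: bigcup_open => U /sD; exact: fU.
Qed.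

Section smyth_map.
Context {X Y : topologicalType}.

Section smyth_map_set.
Variables (f : continuousType X Y) (Q : smyth X).

Lemma smyth_map_neq0 : up (f @` Q) !=set0.
Proof. by have [x Qx] := smyth_neq0 Q; exists (f x); apply: sub_up; exists x. Qed.

Lemma smyth_map_compact : compact (up (f @` Q)).
Proof.
apply: compact_up; apply: continuous_compact; last exact: smyth_compact.
by apply: continuous_subspaceT; exact: cts_fun.
Qed.

Definition smyth_map_fun : smyth Y :=
  Smyth smyth_map_neq0 smyth_map_compact (@saturated_up _ _).

End smyth_map_set.

Lemma smyth_map_box f (U : set Y) : open U ->
  smyth_map_fun f @^-1` box U = box (f @^-1` U).
Proof.
move=> oU; apply/seteqP; split => Q /= QU; first by move=> x Qx; apply/QU/sub_up; exists x.
by apply: up_sub_open => // _ [x /QU ? <-].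
Qed.

Lemma smyth_map_cts f : continuous (smyth_map_fun f).
Proof.
apply: cts_smyth => U oU; rewrite smyth_map_box //.
by apply/open_box/open_cts.
Qed.

Definition smyth_map f : continuousType (smyth X) (smyth Y) :=
  mkcts (@smyth_map_cts f).

End smyth_map.

Section smyth_unit_mult.
Context {X : topologicalType}.

Lemma smyth_unit_neq0 (x : X) : up [set x] !=set0.
Proof. by exists x; exact: sub_up. Qed.

Lemma smyth_unit_compact (x : X) : compact (up [set x]).
Proof. by apply: compact_up; exact: compact_set1. Qed.

Definition smyth_unit_fun (x : X) : smyth X :=
  Smyth (smyth_unit_neq0 x) (@smyth_unit_compact x) (@saturated_up _ _).

Lemma smyth_unit_cts : continuous smyth_unit_fun.
Proof.
apply: cts_smyth => U oU; rewrite (_ : _ @^-1` _ = U) //.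
apply/seteqP; split => x /= Ux; first exact/Ux/sub_up.
by apply: up_sub_open => // _ ->.
Qed.

Definition smyth_unit : continuousType X (smyth X) := mkcts smyth_unit_cts.

Section smyth_mult_set.
Variable QQ : smyth (smyth X).

Lemma smyth_mult_neq0 : \bigcup_(Q in smyth_set QQ) Q !=set0.
Proof.
have [Q QQQ] := smyth_neq0 QQ; have [x Qx] := smyth_neq0 Q.
by exists x, Q.
Qed.

Lemma smyth_mult_compact : compact (\bigcup_(Q in smyth_set QQ) Q).
Proof.
apply/compact_directedP => D [U0 DU0] oD dD QD.
have /compact_directedP/(_ (box @` D)) := @smyth_compact _ QQ.
case; first by exists (box U0), U0.
- by move=> _ [U DU <-]; apply/open_box/oD.
- move=> _ _ [U DU <-] [V DV <-]; have [W DW UVW] := dD _ _ DU DV.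
  exists (box W); first by exists W.
  by move=> Q [] QU x /QU ?; apply: UVW; [left|right].
- move=> Q QQQ.
  have /compact_directedP/(_ D) := @smyth_compact _ Q.
  case=> //; first by exists U0.
    by move=> x Qx; apply: QD; exists Q.
  by move=> U DU QU; exists (box U) => //; exists U.
- move=> _ [U DU <-] QU; exists U => // x [Q QQQ]; exact: QU.
Qed.

Lemma smyth_mult_saturated : saturated (\bigcup_(Q in smyth_set QQ) Q).
Proof.
by move=> y [x [Q QQQ Qx] xy]; exists Q => //; apply: smyth_saturated; exists x.
Qed.

Definition smyth_mult_fun : smyth X :=
  Smyth smyth_mult_neq0 smyth_mult_compact smyth_mult_saturated.

End smyth_mult_set.

Lemma smyth_mult_cts : continuous smyth_mult_fun.
Proof.
apply: cts_smyth => U oU; rewrite (_ : _ @^-1` _ = box (box U)).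
  by apply/open_box/open_box.
by apply/seteqP; split => QQ /= QU; [move=> Q ? x ?; apply: QU; exists Q|
  move=> x [Q /QU]; exact].
Qed.

Definition smyth_mult : continuousType (smyth (smyth X)) (smyth X) :=
  mkcts smyth_mult_cts.

End smyth_unit_mult.

Section smyth_monad.
Implicit Types X Y Z : topologicalType.

Lemma smyth_box_inj X (Q Q' : smyth X) :
  (forall U, open U -> Q `<=` U <-> Q' `<=` U) -> Q = Q'.
Proof.
suff H (P P' : smyth X) : (forall U, open U -> P' `<=` U -> P `<=` U) -> P `<=` P'.
  by move=> QQ'; apply/smythP/seteqP; split; apply: H => U oU /(QQ' _ oU).
move=> PP' x Px; apply: smyth_saturated; apply: contrapT => nx.
pose D := [set U : set X | open U /\ ~ U x].
have /compact_directedP/(_ D) := @smyth_compact _ P'.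
case; first by exists set0; split; [exact: open0|].
- by move=> U [].
- move=> U V [oU nU] [oV nV]; exists (U `|` V) => //.
  by split; [exact: openU|case].
- move=> y P'y; apply: contrapT => ny; apply: nx; exists y => // U oU Uy.
  by apply: contrapT => nUx; apply: ny; exists U.
- by move=> U [oU nUx] P'U; apply: nUx; exact: PP' Px.
Qed.

Lemma smyth_map_id X : smyth_map (ctsid X) = ctsid (smyth X).
Proof.
apply/continuousEP => Q; apply: smythP => /=.
by rewrite image_id saturatedE//; exact: smyth_saturated.
Qed.

Lemma smyth_map_sub X Y (f : continuousType X Y) (Q : smyth X) U :
  open U -> (smyth_map f Q `<=` U <-> Q `<=` f @^-1` U).
Proof. by move=> oU; rewrite -[X in X <-> _]/((smyth_map_fun f @^-1` box U) Q) smyth_map_box. Qed.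

Lemma smyth_unit_sub X (x : X) U : open U -> (smyth_unit x `<=` U <-> U x).
Proof.
by move=> oU; split => [|Ux]; [apply; exact: sub_up|apply: up_sub_open => // _ ->].
Qed.

Lemma smyth_mult_sub X (QQ : smyth (smyth X)) U :
  smyth_mult QQ `<=` U <-> QQ `<=` box U.
Proof. by split=> QU; [move=> Q ? x ?; apply: QU; exists Q|move=> x [Q /QU]; exact]. Qed.

Lemma smyth_map_comp X Y Z (g : continuousType Y Z) (f : continuousType X Y) :
  smyth_map (ctscomp g f) = ctscomp (smyth_map g) (smyth_map f).
Proof.
apply/continuousEP => Q; apply: smyth_box_inj => U oU.
rewrite smyth_map_sub // [X in _ <-> X]smyth_map_sub // smyth_map_sub //.
exact: open_cts.
Qed.

Definition smyth_functor : endofunctor Top :=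
  @Endofunctor Top smyth (@smyth_map) smyth_map_id smyth_map_comp.

Lemma smyth_unit_natural :
  natural (F := fid Top) (G := smyth_functor) (@smyth_unit).
Proof.
move=> X Y f; apply/continuousEP => x; apply: smyth_box_inj => U oU.
apply: iff_trans (smyth_unit_sub (f x) oU) _; apply: iff_sym.
apply: iff_trans (smyth_map_sub f _ oU) _.
by apply: smyth_unit_sub; exact: open_cts.
Qed.

Lemma smyth_mult_natural :
  natural (F := fcomp smyth_functor smyth_functor) (G := smyth_functor)
    (@smyth_mult).
Proof.
move=> X Y f; apply/continuousEP => QQ; apply: smyth_box_inj => U oU.
apply: iff_trans (smyth_mult_sub _ U) _.
apply: iff_trans (smyth_map_sub (smyth_map f) QQ (open_box oU)) _.
apply: iff_sym; apply: iff_trans (smyth_map_sub f (smyth_mult QQ) oU) _.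
by rewrite smyth_mult_sub (smyth_map_box f oU).
Qed.

Lemma smyth_mult_unitl X :
  ctscomp smyth_mult smyth_unit = ctsid (smyth X).
Proof.
apply/continuousEP => Q; apply: smyth_box_inj => U oU.
apply: iff_trans (smyth_mult_sub _ U) _.
by apply: (smyth_unit_sub Q); exact: open_box.
Qed.

Lemma smyth_mult_unitr X :
  ctscomp smyth_mult (smyth_map smyth_unit) = ctsid (smyth X).
Proof.
apply/continuousEP => Q; apply: smyth_box_inj => U oU.
apply: iff_trans (smyth_mult_sub _ U) _.
apply: iff_trans (smyth_map_sub smyth_unit Q (open_box oU)) _.
by split=> H x /H; apply smyth_unit_sub.
Qed.

Lemma smyth_multA X : ctscomp (@smyth_mult X) (@smyth_mult (smyth X)) =
  ctscomp (@smyth_mult X) (smyth_map (@smyth_mult X)).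
Proof.
apply/continuousEP => QQ; apply: smyth_box_inj => U oU.
apply: iff_trans (smyth_mult_sub _ U) _.
apply: iff_trans (smyth_mult_sub _ (box U)) _.
apply: iff_sym; apply: iff_trans (smyth_mult_sub _ U) _.
apply: iff_trans (smyth_map_sub smyth_mult QQ (open_box oU)) _.
by split=> H Q /H; apply smyth_mult_sub.
Qed.

Definition smyth_monad : monad Top :=
  @Monad Top smyth_functor (@smyth_unit) (@smyth_mult)
    smyth_unit_natural smyth_mult_natural
    smyth_mult_unitl smyth_mult_unitr smyth_multA.

End smyth_monad.

Section scott.
Context {d d' : Order.disp_t} {T : porderType d} {T' : porderType d'}.

Definition directed (D : set T) :=
  D !=set0 /\ forall x y, D x -> D y -> exists z, [/\ D z, x <= z & y <= z]%O.

Definition scott_continuous (F : T -> T') :=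
  {homo F : x y / (x <= y)%O} /\
  forall (D : set T) m, directed D -> isLub D m -> isLub (F @` D) (F m).

End scott.

Lemma directed_image d d' (T : porderType d) (T' : porderType d') (F : T -> T')
  (D : set T) : {homo F : x y / (x <= y)%O} -> directed D -> directed (F @` D).
Proof.
move=> mF [[x Dx] dD]; split; first by exists (F x), x.
move=> _ _ [y Dy <-] [z Dz <-]; have [t [Dt yt zt]] := dD _ _ Dy Dz.
by exists (F t); split; [exists t|exact: mF|exact: mF].
Qed.

Section lsc.
Context {R : realType} {X : topologicalType}.
Local Open Scope ereal_scope.

(* Maps to [0, +oo], represented as nonnegative maps to \bar R. *)
Record lsc := Lsc {
  lsc_fun :> X -> \bar R;
  lsc_ge0 : forall x, 0 <= lsc_fun x;
  lsc_lsc : lower_semicontinuous lsc_fun }.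

Lemma lscP (h h' : lsc) : h =1 h' -> h = h'.
Proof.
case: h h' => [f f0 lf] [g g0 lg] /= /funext fg; subst g.
by congr Lsc; exact: Prop_irrelevance.
Qed.

HB.instance Definition _ := gen_eqMixin lsc.
HB.instance Definition _ := gen_choiceMixin lsc.

Definition lsc_le (h h' : lsc) : bool := `[< forall x, h x <= h' x >].

Lemma lsc_le_refl : reflexive lsc_le.
Proof. by move=> h; apply/asboolP. Qed.

Lemma lsc_le_anti : antisymmetric lsc_le.
Proof.
move=> h h' /andP[/asboolP hh' /asboolP h'h].
by apply: lscP => x; apply/eqP; rewrite eq_le hh' h'h.
Qed.

Lemma lsc_le_trans : transitive lsc_le.
Proof.
move=> h h' h'' /asboolP hh' /asboolP h'h; apply/asboolP => x.
exact: le_trans (h'h x).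
Qed.

HB.instance Definition _ := Order.Le_isPOrder.Build FunOrder.fun_display lsc
  lsc_le_refl lsc_le_anti lsc_le_trans.

Lemma lsc_leP (h h' : lsc) : (h <= h')%O <-> forall x, h x <= h' x.
Proof. by split=> [/asboolP|H]; last exact/asboolP. Qed.

Lemma lsc_open (h : lsc) (a : R) : open [set x | a%:E < h x].
Proof. by have /lower_semicontinuousP := @lsc_lsc h; exact. Qed.

Lemma lsc_cst_subproof (c : {nonneg R}) :
  lower_semicontinuous (fun _ : X => c%:num%:E).
Proof. by move=> x a ac; exists setT => //; exact: filterT. Qed.

Lemma lsc_cst_ge0 (c : {nonneg R}) (x : X) : 0 <= c%:num%:E.
Proof. by rewrite lee_fin. Qed.

Definition lsc_cst (c : {nonneg R}) : lsc :=
  Lsc (@lsc_cst_ge0 c) (@lsc_cst_subproof c).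

Lemma lsc_add_subproof (h h' : lsc) :
  lower_semicontinuous (fun x => h x + h' x).
Proof.
move=> x a; have := lsc_ge0 h x; have := lsc_ge0 h' x.
move Ev : (h' x) => v; move Eu : (h x) => u.
have far (g g' : lsc) : g x = +oo ->
    exists2 V, nbhs x V & forall y, V y -> a%:E < g y + g' y.
  move=> gx; exists [set y | a%:E < g y].
    apply: open_nbhs_nbhs; split; first exact: lsc_open.
    by rewrite /= gx ltry.
  by move=> y /= agy; apply: lt_le_trans agy _; rewrite leeDl// lsc_ge0.
case: u v Eu Ev => [u| |] [v| |] // Eu Ev v0 u0; last first.
- by move=> _; exact: far.
- by move=> _; exact: far.
- have [V xV VP] := far h' h Ev; exists V => // y /VP.
  by rewrite addeC.
rewrite -EFinD lte_fin => auv.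
pose e := ((u + v - a) / 2)%R.
have e0 : (0 < e)%R by rewrite divr_gt0// subr_gt0.
exists ([set y | (u - e)%:E < h y] `&` [set y | (v - e)%:E < h' y]).
  apply: open_nbhs_nbhs; split; first by apply: openI; exact: lsc_open.
  by rewrite /= Eu Ev !lte_fin !ltrBlDr !ltrDl.
move=> y [/= hy h'y].
rewrite (_ : a%:E = (u - e)%:E + (v - e)%:E); last first.
  by rewrite -EFinD; congr EFin; rewrite /e; field.
by apply: lteD.
Qed.

Definition lsc_add (h h' : lsc) : lsc :=
  @Lsc (fun x => h x + h' x) (fun x => adde_ge0 (lsc_ge0 h x) (lsc_ge0 h' x))
    (@lsc_add_subproof h h').

Lemma lsc_scale_ge0 (c : {nonneg R}) (h : lsc) x : 0 <= c%:num%:E * h x.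
Proof. by rewrite mule_ge0 ?lee_fin// lsc_ge0. Qed.

Lemma lsc_scale_subproof (c : {nonneg R}) (h : lsc) :
  lower_semicontinuous (fun x => c%:num%:E * h x).
Proof.
move=> x a; have [c0|c0] := leP c%:num 0%R.
  have -> : c%:num = 0%R by apply/eqP; rewrite eq_le c0 /=.
  rewrite mul0e => a0; exists setT; first exact: filterT.
  by move=> y _; rewrite mul0e.
rewrite -lte_pdivrMl// => ah.
exists [set y | (c%:num^-1 * a)%:E < h y].
  by apply: open_nbhs_nbhs; split; [exact: lsc_open|rewrite /= EFinM].
by move=> y /=; rewrite EFinM lte_pdivrMl.
Qed.

Definition lsc_scale (c : {nonneg R}) (h : lsc) : lsc :=
  Lsc (@lsc_scale_ge0 c h) (@lsc_scale_subproof c h).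

End lsc.
Arguments lsc : clear implicits.

Section lsc_lub.
Context {R : realType} {X : topologicalType}.
Local Open Scope ereal_scope.
Variable (D : set (lsc R X)) (D0 : D !=set0).

Lemma lsc_sup_ge0 x : 0 <= ereal_sup [set h x | h in D].
Proof.
have [h Dh] := D0; apply: le_trans (lsc_ge0 h x) _.
by apply: ereal_sup_ubound; exists h.
Qed.

Lemma lsc_sup_subproof :
  lower_semicontinuous (fun x => ereal_sup [set h x | h in D]).
Proof.
move=> x a /ereal_sup_gt[_ [h Dh <-] ahx].
exists [set y | a%:E < h y].
  by apply: open_nbhs_nbhs; split => //; exact: lsc_open.
by move=> y /= /lt_le_trans; apply; apply: ereal_sup_ubound; exists h.
Qed.

Definition lsc_sup : lsc R X := Lsc lsc_sup_ge0 lsc_sup_subproof.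

Lemma isLub_ereal_sup (A : set (\bar R)) m : isLub A m <-> m = ereal_sup A.
Proof.
split=> [[uA lA]|->].
  apply/eqP; rewrite eq_le lA; last exact: ereal_sup_ubound.
  exact: ge_ereal_sup.
by split; [exact: ereal_sup_ubound|move=> b; exact: ge_ereal_sup].
Qed.

(* Nonempty suprema in [lsc R X] are pointwise. *)
Lemma isLub_lscP m : isLub D m <-> forall x, isLub [set h x | h in D] (m x).
Proof.
have sD : isLub D lsc_sup.
  split; first by move=> h Dh; apply/lsc_leP => x; apply: ereal_sup_ubound; exists h.
  move=> b Db; apply/lsc_leP => x; apply: ge_ereal_sup => _ [h /Db + <-].
  by move/lsc_leP.
split=> [[uD lD] x|mD].
  rewrite isLub_ereal_sup; have -> : m = lsc_sup.
    by case: sD => us ls; apply/eqP; rewrite eq_le lD// ls.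
  by [].
suff -> : m = lsc_sup by [].
by apply: lscP => x; exact/isLub_ereal_sup.
Qed.

End lsc_lub.

Section lsc_comp.
Context {R : realType} {X Y : topologicalType}.
Local Open Scope ereal_scope.

Lemma lsc_comp_subproof (h : lsc R Y) (f : continuousType X Y) :
  lower_semicontinuous (h \o f).
Proof.
apply/lower_semicontinuousP => a.
by have := open_cts f (lsc_open h a).
Qed.

Definition lsc_comp (h : lsc R Y) (f : continuousType X Y) : lsc R X :=
  @Lsc R X (h \o f) (fun x => lsc_ge0 h (f x)) (@lsc_comp_subproof h f).

End lsc_comp.

Variant additivity := Linear | Superlinear.

Variant normalization := Unrestricted | Subnormalized | Normalized.

Section prevision.
Context {R : realType} (k : additivity) (b : normalization).
Context {X : topologicalType}.
Local Open Scope ereal_scope.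
Implicit Types (F : lsc R X -> \bar R) (h : lsc R X).

(* The product of \bar R satisfies 0 * +oo = 0, which is the intended
   convention both in [lsc_scale] and on the right-hand side. *)
Definition homogeneous F :=
  forall (a : {nonneg R}) h, F (lsc_scale a h) = a%:num%:E * F h.

Definition linear F := forall h h', F (lsc_add h h') = F h + F h'.

Definition superlinear F := forall h h', F h + F h' <= F (lsc_add h h').

Definition subnormalized F :=
  forall h, F (lsc_add (lsc_cst 1%:nng%R) h) <= 1 + F h.

Definition normalized F :=
  forall h, F (lsc_add (lsc_cst 1%:nng%R) h) = 1 + F h.

Definition additivity_cond F :=
  match k with Linear => linear F | Superlinear => superlinear F end.

Definition normalization_cond F :=
  match b with
  | Unrestricted => True
  | Subnormalized => subnormalized F
  | Normalized => normalized F
  end.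

(* With k = Linear, this is the space of linear previsions, with which the
   space of continuous valuations is identified through nu |-> (h |-> \int h dnu).
   Directed sets being nonempty, Scott continuity into [0, +oo] and into \bar R
   agree on nonnegative maps. *)
Record prevision := Prevision {
  prev_fun :> lsc R X -> \bar R;
  prev_ge0 : forall h, 0 <= prev_fun h;
  prev_scott : scott_continuous prev_fun;
  prev_homogeneous : homogeneous prev_fun;
  prev_additivity : additivity_cond prev_fun;
  prev_normalization : normalization_cond prev_fun }.

Lemma previsionP (F G : prevision) : F =1 G -> F = G.
Proof.
case: F G => [F ? ? ? ? ?] [G ? ? ? ? ?] /= /funext FG; subst G.
by congr Prevision; exact: Prop_irrelevance.
Qed.

HB.instance Definition _ := gen_eqMixin prevision.
HB.instance Definition _ := gen_choiceMixin prevision.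

Definition prev_gt h (r : R) : set prevision := [set F | r%:E < F h].

Definition prev_subbase : set (set prevision) :=
  [set A | exists h r, (0 <= r)%R /\ A = prev_gt h r].

HB.instance Definition _ :=
  isSubBaseTopological.Build prevision prev_subbase id.

Lemma open_prev_gt h r : open (prev_gt h r).
Proof.
have [r0|r0] := leP 0%R r; last first.
  rewrite (_ : prev_gt _ _ = setT); first exact: openT.
  apply/seteqP; split => // F _; apply: lt_le_trans (prev_ge0 F h).
  by rewrite lte_fin.
exists [set prev_gt h r]; last by rewrite bigcup_set1.
by move=> _ ->; apply: (@finI_from1 _ _ _ id); exists h, r.
Qed.

Definition prev_eval h : lsc R prevision :=
  @Lsc R prevision (fun G : prevision => G h) (fun G => prev_ge0 G h)
    (proj2 (lower_semicontinuousP _) (open_prev_gt h)).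

End prevision.
Arguments prevision : clear implicits.
Arguments prev_eval {R k b X}.
Arguments prev_gt {R k b X}.

Lemma cts_prevision R k b (X Y : topologicalType) (f : Y -> prevision R k b X) :
  (forall h r, (0 <= r)%R -> open (f @^-1` prev_gt h r)) -> continuous f.
Proof.
move=> fU; apply/continuousP => A [D sD <-].
rewrite preimage_bigcup; apply: bigcup_open => U /sD[E sE <-].
rewrite openE => x /= Ex; apply: filter_bigI => V EV.
have /set_mem[h [r [r0 VE]]] := sE _ EV.
rewrite VE; apply: open_nbhs_nbhs; split; first exact: fU.
by have := Ex _ EV; rewrite VE.
Qed.

Section prevision_map.
Context {R : realType} {k : additivity} {b : normalization}.
Context {X Y : topologicalType}.
Local Open Scope ereal_scope.
Variable f : continuousType X Y.

Section prevision_map_fun.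
Variable F : prevision R k b X.

Let G (h : lsc R Y) := F (lsc_comp h f).

Lemma prev_map_scott : scott_continuous G.
Proof.
have [mF sF] := prev_scott F.
have mf : {homo (fun h : lsc R Y => lsc_comp h f) : x y / (x <= y)%O}.
  by move=> h h' /lsc_leP hh'; apply/lsc_leP => x; exact: hh'.
split=> [h h' hh'|D m dD Dm]; first exact/mF/mf.
rewrite (_ : G @` D = F @` ((fun h => lsc_comp h f) @` D)); last first.
  by rewrite image_comp.
apply: sF; first exact: directed_image.
have D0 := dD.1; apply/isLub_lscP; first by case: D0 => h Dh; exists (lsc_comp h f), h.
move=> x; move/(isLub_lscP D0)/(_ (f x)) : Dm.
by rewrite image_comp.
Qed.

Lemma prev_map_homogeneous : homogeneous G.
Proof.
move=> a h; rewrite /G -prev_homogeneous; congr (F _); exact: lscP.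
Qed.

Lemma prev_map_additivity : additivity_cond k G.
Proof.
have addE h h' : lsc_comp (lsc_add h h') f =
  lsc_add (lsc_comp h f) (lsc_comp h' f) :> lsc R X by exact: lscP.
by rewrite /G; case: k F => F' h h' /=; rewrite addE;
  exact: (prev_additivity F').
Qed.

Lemma prev_map_normalization : normalization_cond b G.
Proof.
have addE h : lsc_comp (lsc_add (lsc_cst 1%:nng%R) h) f =
  lsc_add (lsc_cst 1%:nng%R) (lsc_comp h f) :> lsc R X by exact: lscP.
by rewrite /G; case: b F => F' //= h; rewrite addE;
  exact: (prev_normalization F').
Qed.

Definition prev_map_fun : prevision R k b Y :=
  @Prevision R k b Y G (fun h => prev_ge0 F (lsc_comp h f)) prev_map_scott
    prev_map_homogeneous prev_map_additivity prev_map_normalization.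

End prevision_map_fun.

Lemma prev_map_cts : continuous prev_map_fun.
Proof. by apply: cts_prevision => h r r0; exact: open_prev_gt. Qed.

Definition prev_map : continuousType (prevision R k b X) (prevision R k b Y) :=
  mkcts prev_map_cts.

End prevision_map.

Section prevision_unit_mult.
Context {R : realType} {k : additivity} {b : normalization}.
Context {X : topologicalType}.
Local Open Scope ereal_scope.

Section prevision_unit_fun.
Variable x : X.

Let G (h : lsc R X) := h x.

Lemma prev_unit_scott : scott_continuous G.
Proof.
split=> [h h' /lsc_leP|D m dD Dm]; first exact.
by move/(isLub_lscP dD.1) : Dm; exact.
Qed.

Lemma prev_unit_homogeneous : homogeneous G. Proof. by []. Qed.

Lemma prev_unit_additivity : additivity_cond k G.
Proof. by case: k => h h' //=. Qed.

Lemma prev_unit_normalization : normalization_cond b G.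
Proof. by case: b => //= h; exact: lexx. Qed.

Definition prev_unit_fun : prevision R k b X :=
  @Prevision R k b X G (fun h => lsc_ge0 h x) prev_unit_scott
    prev_unit_homogeneous prev_unit_additivity prev_unit_normalization.

End prevision_unit_fun.

Lemma prev_unit_cts : continuous prev_unit_fun.
Proof. by apply: cts_prevision => h r r0; exact: lsc_open. Qed.

Definition prev_unit : continuousType X (prevision R k b X) :=
  mkcts prev_unit_cts.

Section prevision_mult_fun.
Variable FF : prevision R k b (prevision R k b X).

Let G (h : lsc R X) := FF (prev_eval h).

Lemma prev_mult_scott : scott_continuous G.
Proof.
have [mF sF] := prev_scott FF.
have me : {homo @prev_eval R k b X : x y / (x <= y)%O}.
  by move=> h h' hh'; apply/lsc_leP => F; exact: (prev_scott F).1.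
split=> [h h' hh'|D m dD Dm]; first exact/mF/me.
rewrite (_ : G @` D = FF @` (@prev_eval R k b X @` D)); last first.
  by rewrite image_comp.
apply: sF; first exact: directed_image.
have [h Dh] := dD.1; apply/isLub_lscP; first by exists (prev_eval h), h.
by move=> F; rewrite image_comp; exact: (prev_scott F).2.
Qed.

Lemma prev_mult_homogeneous : homogeneous G.
Proof.
move=> a h; rewrite /G -prev_homogeneous; congr (FF _); apply: lscP => F /=.
exact: prev_homogeneous.
Qed.

Lemma prev_mult_additivity : additivity_cond k G.
Proof.
rewrite /G; case: k FF => FF' h h'.
  apply: etrans (prev_additivity FF' _ _); congr (FF' _); apply: lscP => F.
  exact: (prev_additivity F).
apply: le_trans (prev_additivity FF' _ _) _; apply: (prev_scott FF').1.
by apply/lsc_leP => F; exact: (prev_additivity F).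
Qed.

Lemma prev_mult_normalization : normalization_cond b G.
Proof.
rewrite /G; case: b FF => FF' //= h.
  apply: le_trans (prev_normalization FF' _); apply: (prev_scott FF').1.
  by apply/lsc_leP => F; exact: (prev_normalization F).
apply: etrans (prev_normalization FF' _); congr (FF' _); apply: lscP => F.
exact: (prev_normalization F).
Qed.

Definition prev_mult_fun : prevision R k b X :=
  @Prevision R k b X G (fun h => prev_ge0 FF (prev_eval h)) prev_mult_scott
    prev_mult_homogeneous prev_mult_additivity prev_mult_normalization.

End prevision_mult_fun.

Lemma prev_mult_cts : continuous prev_mult_fun.
Proof. by apply: cts_prevision => h r r0; exact: open_prev_gt. Qed.

Definition prev_mult :
  continuousType (prevision R k b (prevision R k b X)) (prevision R k b X) :=
  mkcts prev_mult_cts.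

End prevision_unit_mult.

Section prevision_monad.
Context (R : realType) (k : additivity) (b : normalization).
Implicit Types X Y Z : topologicalType.
Local Notation P := (prevision R k b).

Lemma prev_map_id X : prev_map (ctsid X) = ctsid (P X).
Proof.
apply/continuousEP => F; apply: previsionP => h; congr (F _); exact: lscP.
Qed.

Lemma prev_map_comp X Y Z (g : continuousType Y Z) (f : continuousType X Y) :
  prev_map (ctscomp g f) = ctscomp (prev_map g) (@prev_map R k b _ _ f).
Proof.
apply/continuousEP => F; apply: previsionP => h; congr (F _); exact: lscP.
Qed.

Definition prev_functor : endofunctor Top :=
  @Endofunctor Top (prevision R k b) (@prev_map R k b) prev_map_id prev_map_comp.

Lemma prev_unit_natural :
  natural (F := fid Top) (G := prev_functor) (@prev_unit R k b).
Proof. by move=> X Y f; apply/continuousEP => x; exact: previsionP. Qed.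

Lemma prev_mult_natural :
  natural (F := fcomp prev_functor prev_functor) (G := prev_functor)
    (@prev_mult R k b).
Proof.
move=> X Y f; apply/continuousEP => FF; apply: previsionP => h; congr (FF _).
exact: lscP.
Qed.

Lemma prev_mult_unitl X : ctscomp prev_mult prev_unit = ctsid (P X).
Proof. by apply/continuousEP => F; exact: previsionP. Qed.

Lemma prev_mult_unitr X : ctscomp prev_mult (prev_map prev_unit) = ctsid (P X).
Proof.
apply/continuousEP => F; apply: previsionP => h; congr (F _); exact: lscP.
Qed.

Lemma prev_multA X : ctscomp prev_mult (@prev_mult R k b (P X)) =
  ctscomp prev_mult (prev_map (@prev_mult R k b X)).
Proof.
apply/continuousEP => F; apply: previsionP => h; congr (F _); exact: lscP.
Qed.

Definition prev_monad : monad Top :=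
  @Monad Top prev_functor (@prev_unit R k b) (@prev_mult R k b)
    prev_unit_natural prev_mult_natural
    prev_mult_unitl prev_mult_unitr prev_multA.

End prevision_monad.

Definition is_min d (T : porderType d) (A : set T) (m : T) := A m /\ lbound A m.

(* Main.v *)
Require Import Defs.
From HB Require Import structures.
From mathcomp Require Import all_boot all_order all_algebra.
From mathcomp Require Import ring lra.
From mathcomp Require Import all_classical all_reals all_analysis.
Set Implicit Arguments.
Unset Strict Implicit.
Unset Printing Implicit Defensive.
Import Order.TTheory GRing.Theory Num.Theory.
Import numFieldNormedType.Exports.
Local Open Scope classical_set_scope.
Local Open Scope ring_scope.
Local Open Scope ereal_scope.

(** Everything rests on a sandwich theorem: if a superlinear prevision F satisfies
F y <= b for all pairs (y, b) of a convex cone K, then some linear prevision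
G >= F satisfies the same bounds. By Zorn's lemma there is a maximal
Scott-continuous superlinear q with F <= q <= K. The functional
x |-> sup {q (x + y) - b | (y, b) in K} is again such, so that
q (x + y) <= q x + b on K; applying the same construction to the cone of all
(t a, t q a), which by the previous inequality does not leave the bound K, gives
q (x + a) <= q x + q a. Normalization is obtained by adding (1, 1) to K.

Taking for K the bounds that hold almost everywhere for an ultrafilter of linear
previsions yields at once the compactness of the sets of dominating linear
previsions and the continuity of s. Taking for K bounds imposed by a given
linear prevision yields the naturality of s and the last two equations of a
distributing retraction. The equations for r are read off
r Q h > a <-> Q `<=` [h > a]. *)

(** * Extended reals compared through finite strict lower bounds *)

Section ereal_order.
Context {R : realType}.
Implicit Types x y z : \bar R.

Lemma lt_fin_between x y : x < y -> exists2 a : R, x < a%:E & a%:E < y.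
Proof.
case: x y => [x| |] [y| |] //=.
- by rewrite lte_fin => xy; exists ((x + y) / 2)%R; rewrite lte_fin; lra.
- by exists (x + 1)%R; rewrite ?ltry// lte_fin; lra.
- by exists (y - 1)%R; rewrite ?ltNyr// lte_fin; lra.
- by exists 0%R; rewrite ?ltry ?ltNyr.
Qed.

Lemma le_fin_lt x y : (forall a : R, a%:E < x -> a%:E <= y) -> x <= y.
Proof.
move=> H; rewrite leNgt; apply/negP => /lt_fin_between[a ya ax].
by have := H _ ax; rewrite leNgt ya.
Qed.

Lemma eq_fin_lt x y : (forall a : R, a%:E < x <-> a%:E < y) -> x = y.
Proof.
move=> xy; apply/le_anti/andP; split; apply: le_fin_lt => a /xy; exact: ltW.
Qed.

(** Lets superlinearity of a supremum be checked on finite approximations of both summands, with no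
    case distinction on infinite values. *)
Lemma adde_le_fin_lt x y z : 0 <= x -> 0 <= y ->
  (forall a b : R, a%:E < x -> b%:E < y -> (a + b)%:E <= z) -> x + y <= z.
Proof.
move=> x0 y0 H; apply: le_fin_lt => c; case: x y x0 y0 H => [x| |] [y| |] //.
- move=> _ _ H; rewrite -EFinD lte_fin => cxy.
  have -> : c = (x - (x + y - c) / 2 + (y - (x + y - c) / 2))%R by field.
  by apply: H; rewrite lte_fin; lra.
- move=> _ _ H _; have -> : c = (x - 1 + (c - x + 1))%R by ring.
  by apply: H; rewrite ?ltry// lte_fin; lra.
- move=> _ _ H _; have -> : c = (c - y + 1 + (y - 1))%R by ring.
  by apply: H; rewrite ?ltry// lte_fin; lra.
- move=> _ _ H _; have -> : c = (c + 0)%R by ring.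
  by apply: H; rewrite ltry.
Qed.

End ereal_order.

(** * Scott-continuous functionals and the cone of lower semicontinuous maps *)

Section scott_ereal.
Context {R : realType} {d : Order.disp_t} {T : porderType d}.

Lemma scott_continuousP (F : T -> \bar R) : scott_continuous F <->
  {homo F : x y / (x <= y)%O} /\
  forall D m (a : R), directed D -> isLub D m -> a%:E < F m ->
    exists2 x, D x & a%:E < F x.
Proof.
split=> -[mF sF]; split=> // D m.
  move=> a dD /(sF _ _ dD)/isLub_ereal_sup -> /ereal_sup_gt[_ [x Dx <-]].
  by exists x.
move=> dD Dm; split; first by move=> _ [x Dx <-]; exact/mF/Dm.1.
move=> c Dc; apply: le_fin_lt => a /(sF _ _ _ dD Dm)[x Dx] /ltW /le_trans; apply.
by apply: Dc; exists x.
Qed.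

(** A strict lower bound of the supremum is already one of a single [f i], whose Scott continuity
    supplies the point of [D]. *)
Lemma scott_continuous_sup (I : Type) (P : set I) (f : I -> T -> \bar R) :
  (forall i, P i -> scott_continuous (f i)) ->
  scott_continuous (fun x => ereal_sup [set f i x | i in P]).
Proof.
move=> sf; apply/scott_continuousP; split=> [x y xy|D m a dD Dm].
  apply: ge_ereal_sup => _ [i Pi <-]; apply: le_trans ((sf i Pi).1 _ _ xy) _.
  by apply: ereal_sup_ubound; exists i.
move=> /ereal_sup_gt[_ [i Pi <-]] /((scott_continuousP _).1 (sf i Pi)).2.
move=> /(_ _ dD Dm)[x Dx ax]; exists x => //; apply: lt_le_trans ax _.
by apply: ereal_sup_ubound; exists i.
Qed.

End scott_ereal.

Section lsc_algebra.
Context {R : realType} {X : topologicalType}.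
Implicit Types (h y : lsc R X) (F : lsc R X -> \bar R).

Lemma lsc_addC h h' : lsc_add h h' = lsc_add h' h.
Proof. by apply: lscP => x; exact: addeC. Qed.

Lemma lsc_addACA h h' y y' :
  lsc_add (lsc_add h h') (lsc_add y y') = lsc_add (lsc_add h y) (lsc_add h' y').
Proof. by apply: lscP => x; exact: addeACA. Qed.

Lemma lsc_add0 h : lsc_add h (lsc_cst 0%:nng%R) = h.
Proof. by apply: lscP => x; exact: adde0. Qed.

Lemma lsc_scale0 (c : {nonneg R}) h : c%:num = 0%R -> lsc_scale c h = lsc_cst 0%:nng%R.
Proof. by move=> c0; apply: lscP => x /=; rewrite c0 mul0e. Qed.

Lemma lsc_scaleA (c c' : {nonneg R}) h :
  lsc_scale c (lsc_scale c' h) = lsc_scale (c%:num * c'%:num)%:nng%R h.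
Proof. by apply: lscP => x /=; rewrite EFinM muleA. Qed.

Lemma lsc_scale1 (c : {nonneg R}) h : c%:num = 1%R -> lsc_scale c h = h.
Proof. by move=> c1; apply: lscP => x /=; rewrite c1 mul1e. Qed.

Lemma lsc_scaleDr (c : {nonneg R}) h h' :
  lsc_scale c (lsc_add h h') = lsc_add (lsc_scale c h) (lsc_scale c h').
Proof. by apply: lscP => x /=; rewrite ge0_muleDr// lsc_ge0. Qed.

Lemma lsc_scaleDl (c c' : {nonneg R}) h :
  lsc_add (lsc_scale c h) (lsc_scale c' h) = lsc_scale (c%:num + c'%:num)%:nng%R h.
Proof. by apply: lscP => x /=; rewrite EFinD ge0_muleDl ?lee_fin. Qed.

Lemma lsc_leD h h' y y' : (h <= h')%O -> (y <= y')%O ->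
  (lsc_add h y <= lsc_add h' y')%O.
Proof.
by move=> /lsc_leP hh' /lsc_leP yy'; apply/lsc_leP => x; exact: leeD.
Qed.

(** Pointwise: where [y] is finite it can be subtracted; where it is [+oo], a member of the
    non-empty [D] forces the upper bound [c] to be [+oo]. *)
Lemma isLub_lsc_addr (D : set (lsc R X)) m y : D !=set0 -> isLub D m ->
  isLub ((lsc_add^~ y) @` D) (lsc_add m y).
Proof.
move=> D0 Dm; split.
  by move=> _ [h /Dm.1 hm <-]; exact: lsc_leD.
move=> c Dc; apply/lsc_leP => x /=.
have {}Dc h : D h -> h x + y x <= c x.
  by move=> Dh; have /lsc_leP := Dc (lsc_add h y) (ex_intro2 _ _ h Dh erefl); exact.
have := lsc_ge0 y x; case yx : (y x) => [v| |] // _; last first.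
  case: D0 => h /Dc; rewrite yx addey; last first.
    by rewrite gt_eqF// (lt_le_trans _ (lsc_ge0 h x)).
  by rewrite leye_eq => /eqP ->; rewrite leey.
rewrite -leeBrDr//; apply: ((isLub_lscP D0 m).1 Dm x).2 => _ [h /Dc + <-].
by rewrite yx leeBrDr.
Qed.

Lemma scott_continuous_shift F y (b : R) : scott_continuous F ->
  scott_continuous (fun h => F (lsc_add h y) - b%:E).
Proof.
move=> sF; have [mF F_lub] := (scott_continuousP _).1 sF.
have my : {homo lsc_add^~ y : h h' / (h <= h')%O}.
  by move=> h h' hh'; exact: lsc_leD.
apply/scott_continuousP; split=> [h h' hh'|D m a dD Dm].
  by apply: leeB => //; exact/mF/my.
rewrite lteBrDr// -EFinD => /(F_lub _ _ _ (directed_image my dD)).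
move=> /(_ (isLub_lsc_addr y dD.1 Dm))[_ [h Dh <-] ah].
by exists h => //; rewrite lteBrDr.
Qed.

(** For [c > 0] the reverse inequality is the assumed one for the scalar [c^-1] and the map
    [c h]. *)
Lemma homogeneous_supscale F : (forall h, 0 <= F h) ->
  F (lsc_cst 0%:nng%R) <= 0 ->
  (forall (c : {nonneg R}) h, (0 < c%:num)%R -> c%:num%:E * F h <= F (lsc_scale c h)) ->
  homogeneous F.
Proof.
move=> F_ge0 F0 FZ c h; have [c0|c0] := leP c%:num 0%R.
  have {}c0 : c%:num = 0%R by apply/le_anti; rewrite c0 /=.
  by rewrite lsc_scale0// c0 mul0e; apply/le_anti; rewrite F0 F_ge0.
apply/le_anti; rewrite FZ// andbT -lee_pdivrMl//.
have ic0 : (0 < c%:num^-1)%R by rewrite invr_gt0.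
have := FZ (NngNum (ltW ic0)) (lsc_scale c h) ic0.
suff -> : lsc_scale (NngNum (ltW ic0)) (lsc_scale c h) = h by [].
by rewrite lsc_scaleA; apply: lsc_scale1; rewrite /= mulVf// gt_eqF.
Qed.

End lsc_algebra.

(** * Normalization, convergence and specialization of previsions *)

Section prevision_facts.
Context {R : realType} {k : additivity} {b : normalization} {X : topologicalType}.
Implicit Types (G : prevision R k b X) (h : lsc R X).

Lemma prev_le G h h' : (h <= h')%O -> G h <= G h'.
Proof. exact: (prev_scott G).1. Qed.

Lemma prev0 G : G (lsc_cst 0%:nng%R) = 0.
Proof.
rewrite -(lsc_scale0 (c := 0%:nng%R) (lsc_cst 0%:nng%R))//.
by rewrite (prev_homogeneous G) mul0e.
Qed.

Lemma prev_subnormalized G : b <> Unrestricted -> subnormalized G.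
Proof.
case: b G => // G _ h; [exact: (prev_normalization G)|].
by rewrite (prev_normalization G).
Qed.

(** For [s > 0], [h + s = s (1 + s^-1 h)], so homogeneity reduces the constant [s] to [1]. *)
Lemma subnormalizedD G : subnormalized G -> forall h (s : {nonneg R}),
  G (lsc_add h (lsc_cst s)) <= G h + s%:num%:E.
Proof.
move=> subG h s; have [s0|s0] := leP s%:num 0%R.
  have {}s0 : s%:num = 0%R by apply/le_anti; rewrite s0 /=.
  have -> : lsc_add h (lsc_cst s) = h by apply: lscP => x /=; rewrite s0 adde0.
  by rewrite s0 adde0.
have is0 : (0 < s%:num^-1)%R by rewrite invr_gt0.
pose s' := NngNum (ltW is0).
have -> : lsc_add h (lsc_cst s) =
    lsc_scale s (lsc_add (lsc_cst 1%:nng%R) (lsc_scale s' h)).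
  rewrite lsc_scaleDr lsc_addC lsc_scaleA [lsc_scale _ h]lsc_scale1; last first.
    by rewrite /= mulfV// gt_eqF.
  by congr lsc_add; apply: lscP => x /=; rewrite mule1.
rewrite (prev_homogeneous G); apply: le_trans (lee_wpmul2l _ (subG _)) _.
  by rewrite lee_fin.
rewrite (prev_homogeneous G) ge0_muleDr ?mule_ge0 ?prev_ge0 ?lee_fin//.
by rewrite mule1 muleA -EFinM /= mulfV ?gt_eqF// mul1e addeC.
Qed.

Lemma prev_cvg (FF : set_system (prevision R k b X)) G : Filter FF ->
  (forall h a, a%:E < G h -> FF (prev_gt h a)) -> FF --> G.
Proof.
move=> FFF FFG V; rewrite nbhsE => -[U [[D sD <-] [E DE EG]] UV].
apply: filterS UV _; have [W sW WE] := sD _ DE; subst E.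
apply: filterS (bigcup_sup DE) _; apply: filter_bigI => B WB.
have /set_mem[h [a [_ BE]]] := sW _ WB; rewrite BE; apply: FFG.
by have := EG _ WB; rewrite BE.
Qed.

Lemma prev_spec_le G G' : spec_le G G' <-> forall h, G h <= G' h.
Proof.
split=> [GG' h|GG' U oU UG].
  by apply: le_fin_lt => a ah; apply/ltW/(GG' (prev_gt h a)) => //; exact: open_prev_gt.
(* The principal filter at [G'] converges to [G] exactly when [G'] lies in every neighborhood of
   [G]. *)
have /(_ U (open_nbhs_nbhs (conj oU UG))) : globally [set G'] --> G; last exact.
by apply: prev_cvg => h a ah _ ->; exact: lt_le_trans (GG' h).
Qed.

End prevision_facts.

(** * The sandwich theorem *)

Section sandwich.
Context {R : realType} {X : topologicalType}.
Implicit Types (h y : lsc R X) (K : set (lsc R X * R)).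
Local Notation superprev := (prevision R Superlinear Unrestricted X).
Implicit Types q : superprev.

(* A cone [K] of pairs [(y, b)] stands for the sublinear functional
   [y |-> inf {b | K (y, b)}], which need not be monotone nor continuous. *)
Definition constraint_cone K :=
  [/\ K (lsc_cst 0%:nng%R, 0%R),
      forall y y' b b', K (y, b) -> K (y', b') -> K (lsc_add y y', (b + b')%R) &
      forall (c : {nonneg R}) y b, K (y, b) -> K (lsc_scale c y, (c%:num * b)%R)].

Definition dominated (F : lsc R X -> \bar R) K := forall y b, K (y, b) -> F y <= b%:E.

(** Closure of [K] under sums and scalings makes the supremum superlinear and homogeneous;
    [dominated q K] makes it vanish at [0]. The two clauses determine its values without any
    subtraction. *)
Lemma cone_extension q K : constraint_cone K -> dominated q K ->
  exists q', (forall h y b, K (y, b) -> q (lsc_add h y) <= q' h + b%:E) /\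
    (forall h c, (forall y b, K (y, b) -> q (lsc_add h y) <= c + b%:E) -> q' h <= c).
Proof.
move=> [K0 KD KZ] qK.
pose f h := ereal_sup [set q (lsc_add h p.1) - p.2%:E | p in K].
have f_ub h y b : K (y, b) -> q (lsc_add h y) - b%:E <= f h.
  by move=> Kyb; apply: ereal_sup_ubound; exists (y, b).
have f_lub h c : (forall y b, K (y, b) -> q (lsc_add h y) <= c + b%:E) -> f h <= c.
  by move=> H; apply: ge_ereal_sup => _ [[y b] Kyb <-]; rewrite leeBlDr//; exact: H.
have f_ge0 h : 0 <= f h.
  by apply: le_trans (f_ub _ _ _ K0); rewrite sube0 prev_ge0.
have f_scott : scott_continuous f.
  apply: scott_continuous_sup => -[y b] _; apply: scott_continuous_shift.
  exact: prev_scott.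
have f_hom : homogeneous f.
  apply: homogeneous_supscale => // [|c h c0].
    by apply: f_lub => y b Kyb; rewrite add0e lsc_addC lsc_add0 qK.
  rewrite -lee_pdivlMl//; apply: f_lub => y b Kyb.
  rewrite -leeBlDr// lee_pdivlMl// muleBr ?fin_num_adde_defl//.
  rewrite -(prev_homogeneous q) lsc_scaleDr -EFinM.
  exact/f_ub/KZ.
have f_super : superlinear f.
  move=> h h'; apply: adde_le_fin_lt => // a a'.
  move=> /ereal_sup_gt[_ [[y b] Kyb <-]] + /ereal_sup_gt[_ [[y' b'] Kyb' <-]].
  rewrite !lteBrDr//= => ha ha'.
  apply: le_trans (f_ub _ _ _ (KD _ _ _ _ Kyb Kyb')).
  rewrite leeBrDr// lsc_addACA.
  apply: le_trans (prev_additivity q _ _); apply: le_trans (ltW (lteD ha ha')).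
  by rewrite -!EFinD lee_fin; lra.
exists (@Prevision R Superlinear Unrestricted X f f_ge0 f_scott f_hom f_super I).
split=> // h y b Kyb; by rewrite -leeBlDr// f_ub.
Qed.

(** Comparability enters through superlinearity: approximations of the values at [h] and at [h']
    must come from one member of [A]. *)
Lemma chain_sup (A : set superprev) : A !=set0 ->
  (forall q q', A q -> A q' -> (forall h, q h <= q' h) \/ (forall h, q' h <= q h)) ->
  exists q, forall h, q h = ereal_sup [set q' h | q' in A].
Proof.
move=> [q0 Aq0] chA; pose f h := ereal_sup [set q h | q in A].
have f_ub q h : A q -> q h <= f h by move=> Aq; apply: ereal_sup_ubound; exists q.
have f_ge0 h : 0 <= f h by apply: le_trans (f_ub _ h Aq0); exact: prev_ge0.
have f_scott : scott_continuous f.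
  apply: (scott_continuous_sup (f := fun q : superprev => q : lsc R X -> \bar R)).
  by move=> q _; exact: prev_scott.
have f_hom : homogeneous f.
  apply: homogeneous_supscale => // [|c h c0].
    by apply: ge_ereal_sup => _ [q _ <-]; rewrite prev0.
  rewrite -lee_pdivlMl//; apply: ge_ereal_sup => _ [q Aq <-].
  by rewrite lee_pdivlMl// -(prev_homogeneous q) f_ub.
have f_super : superlinear f.
  move=> h h'; apply: adde_le_fin_lt => // a a'.
  move=> /ereal_sup_gt[_ [q Aq <-]] aq /ereal_sup_gt[_ [q' Aq' <-]] aq'.
  have [q'' [Aq'' qh q'h]] : exists q'', [/\ A q'', q h <= q'' h & q' h' <= q'' h'].
    by have [qq'|q'q] := chA _ _ Aq Aq'; [exists q'|exists q].
  apply: le_trans (f_ub _ _ Aq''); apply: le_trans (prev_additivity q'' _ _).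
  by rewrite EFinD; apply: leeD; apply/ltW;
    [exact: lt_le_trans qh|exact: lt_le_trans q'h].
by exists (@Prevision R Superlinear Unrestricted X f f_ge0 f_scott f_hom f_super I).
Qed.

Lemma maximal_dominated q0 K : dominated q0 K -> exists q,
  [/\ forall h, q0 h <= q h, dominated q K &
    forall q', (forall h, q h <= q' h) -> dominated q' K -> forall h, q' h <= q h].
Proof.
move=> q0K.
pose T := {q : superprev | (forall h, q0 h <= q h) /\ dominated q K}.
pose le (q q' : T) := `[< forall h, sval q h <= sval q' h >].
pose t0 : T := exist _ q0 (conj (fun h => lexx _) q0K).
have [|||[q [q0q qK]] qmax] := @ZL_preorder T t0 le.
- by move=> q; apply/asboolP.
- move=> q q' q'' /asboolP qq' /asboolP qq''; apply/asboolP => h.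
  exact: le_trans (qq'' h).
- move=> A chA; have [[q1 Aq1]|A0] := pselect (A !=set0); last first.
    by exists t0 => q Aq; case: A0; exists q.
  have [||q supq] := @chain_sup (@sval _ _ @` A); first by exists (sval q1), q1.
    move=> _ _ [q Aq <-] [q' Aq' <-].
    by have [/asboolP|/asboolP] := chA _ _ Aq Aq'; [left|right].
  have q_ub (t : T) h : A t -> sval t h <= q h.
    move=> At; rewrite supq; apply: ereal_sup_ubound.
    by exists (sval t) => //; exists t.
  have q0q h : q0 h <= q h by exact: le_trans ((svalP q1).1 h) (q_ub _ _ Aq1).
  have qK : dominated q K.
    move=> y b Kyb; rewrite supq; apply: ge_ereal_sup => _ [_ [q' _ <-] <-].
    exact: (svalP q').2.
  by exists (exist _ q (conj q0q qK)) => q' Aq'; apply/asboolP => h; exact: q_ub.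
exists q; split=> // q' qq' q'K.
have q0q' h : q0 h <= q' h by exact: le_trans (qq' h).
have /(_ (asboolT _))/asboolP := qmax (exist _ q' (conj q0q' q'K)); exact.
Qed.

Lemma maximal_dominated_linear q K : constraint_cone K -> dominated q K ->
  (forall q', (forall h, q h <= q' h) -> dominated q' K -> forall h, q' h <= q h) ->
  Defs.linear q.
Proof.
move=> coneK qK qmax; have [K0 KD KZ] := coneK.
(* The extension of [q] by [K'] lies above [q]; the bound on mixed sums keeps it dominated by [K],
   so maximality brings it back below [q]. *)
have qle K' : constraint_cone K' -> dominated q K' ->
    (forall y b y' b', K (y, b) -> K' (y', b') -> q (lsc_add y y') <= (b + b')%:E) ->
    forall h y b, K' (y, b) -> q (lsc_add h y) <= q h + b%:E.
  move=> coneK' qK' KK' h y b Kyb.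
  have [q' [q'_ub q'_lub]] := cone_extension coneK' qK'.
  apply: le_trans (q'_ub _ _ _ Kyb) _; rewrite leeD2r//; apply: qmax => [h'|y' b' Kyb'].
    by case: coneK' => /(q'_ub h') + _ _; rewrite lsc_add0 adde0.
  by apply: q'_lub => y'' b'' Kyb''; rewrite -EFinD KK'.
have {}qmaxK := qle K coneK qK (fun _ _ _ _ Kyb Kyb' => qK _ _ (KD _ _ _ _ Kyb Kyb')).
move=> h a; apply/le_anti; rewrite (prev_additivity q) andbT.
case qa : (q a) => [v| |]; first last.
- by have := prev_ge0 q a; rewrite qa.
- by rewrite addey ?leey// gt_eqF// (lt_le_trans _ (prev_ge0 q h)).
(* The ray through [(a, q a)]: its point at [t = 1] gives subadditivity, and [qmaxK] bounds its
   mixed sums with [K]. *)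
pose K' := [set p : lsc R X * R |
  exists t : {nonneg R}, p = (lsc_scale t a, (t%:num * v)%R)].
apply: (qle K'); last 1 first.
- by exists 1%:nng%R; rewrite lsc_scale1//= mul1r.
- split; first by exists 0%:nng%R; rewrite lsc_scale0//= mul0r.
    move=> _ _ _ _ [t [-> ->]] [t' [-> ->]]; exists (t%:num + t'%:num)%:nng%R.
    by rewrite lsc_scaleDl -mulrDl.
  move=> c _ _ [t [-> ->]]; exists (c%:num * t%:num)%:nng%R.
  by rewrite lsc_scaleA mulrA.
- by move=> _ _ [t [-> ->]]; rewrite prev_homogeneous qa.
move=> y b _ _ Kyb [t [-> ->]]; rewrite lsc_addC; apply: le_trans (qmaxK _ _ _ Kyb) _.
by rewrite prev_homogeneous qa -EFinM -EFinD addrC.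
Qed.

End sandwich.

Lemma sandwich {R : realType} {b : normalization} {X : topologicalType}
  (F : prevision R Superlinear b X) (K : set (lsc R X * R)) :
  constraint_cone K -> dominated F K ->
  exists G : prevision R Linear b X, (forall h, F h <= G h) /\ dominated G K.
Proof.
move=> [K0 KD KZ] FK.
pose F' := @Prevision R Superlinear Unrestricted X F (prev_ge0 F) (prev_scott F)
  (prev_homogeneous F) (prev_additivity F) I.
(* Zorn's lemma is applied without normalization; instead the pairs [(s, s)] force [q 1 <= 1]. In
   the unrestricted case [s = 0], as [F] may violate such bounds. *)
pose K' := [set p | exists y c (s : {nonneg R}),
  [/\ K (y, c), p = (lsc_add y (lsc_cst s), (c + s%:num)%R) &
      b = Unrestricted -> s%:num = 0%R]].
have KK' : K `<=` K'.
  move=> [y c] Kyc; exists y, c, 0%:nng%R; split=> //.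
  by rewrite lsc_add0 addr0.
have coneK' : constraint_cone K'.
  split; first exact: KK'.
    move=> _ _ _ _ [y [c [s [Kyc [-> ->] bs]]]] [y' [c' [s' [Kyc' [-> ->] bs']]]].
    exists (lsc_add y y'), (c + c')%R, (s%:num + s'%:num)%:nng%R; split=> [||bU].
    - exact: KD.
    - rewrite lsc_addACA addrACA; congr pair; congr lsc_add.
      by apply: lscP => x /=; rewrite EFinD.
    - by rewrite /= bs// bs'// addr0.
  move=> t _ _ [y [c [s [Kyc [-> ->] bs]]]].
  exists (lsc_scale t y), (t%:num * c)%R, (t%:num * s%:num)%:nng%R; split=> [||bU].
  - exact: KZ.
  - rewrite lsc_scaleDr mulrDr; congr pair; congr lsc_add.
    by apply: lscP => x /=; rewrite EFinM.
  - by rewrite /= bs// mulr0.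
have F'K' : dominated F' K'.
  move=> _ _ [y [c [s [Kyc [-> ->] bs]]]]; rewrite EFinD.
  apply: (@le_trans _ _ (F y + s%:num%:E)); last by apply: leeD => //; exact: FK.
  have [bU|bU] := pselect (b = Unrestricted).
    have -> : lsc_add y (lsc_cst s) = y by apply: lscP => x /=; rewrite bs// adde0.
    by rewrite bs// adde0.
  exact: (subnormalizedD (prev_subnormalized F bU)).
have [q [Fq qK' qmax]] := maximal_dominated F'K'.
have q_lin := maximal_dominated_linear coneK' qK' qmax.
have q1 : b <> Unrestricted -> q (lsc_cst 1%:nng%R) <= 1.
  move=> bU; apply: qK'; exists (lsc_cst 0%:nng%R), 0%R, 1%:nng%R; split=> //.
  by rewrite lsc_addC lsc_add0 add0r.
have q1_ge : normalized F -> 1 <= q (lsc_cst 1%:nng%R).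
  move=> F_norm; apply: le_trans (Fq _).
  by rewrite /= -[lsc_cst _]lsc_add0 F_norm leeDl// prev_ge0.
(* As [q] is linear, its normalization depends on [q 1] alone. *)
have q_norm : normalization_cond b q.
  clear -q1 q1_ge q_lin F; case: b F q1 q1_ge => //= F q1 q1_ge h; rewrite q_lin.
    by apply: leeD => //; exact: q1.
  congr (_ + _); apply/le_anti; rewrite q1//= q1_ge//; exact: (prev_normalization F).
exists (@Prevision R Linear b X q (prev_ge0 q) (prev_scott q) (prev_homogeneous q)
  q_lin q_norm); split=> [//|y c /KK']; exact: qK'.
Qed.

(** * The map [s]: compact sets of linear dominators *)

Section dominators.
Context {R : realType} {b : normalization} {X : topologicalType}.
Implicit Types (F : prevision R Superlinear b X) (G : prevision R Linear b X).

Definition dominators_set F : set (prevision R Linear b X) :=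
  [set G | forall h, F h <= G h].

(* The bounds that hold on a set of [UU] form a constraint cone dominating [F];
   since [UU] is an ultrafilter, it converges to any dominator of [F] satisfying
   them. *)
Lemma ultra_dominator F (UU : set_system (prevision R Linear b X)) :
  UltraFilter UU -> (forall h a, a%:E < F h -> UU (prev_gt h a)) ->
  exists2 G, dominators_set F G & UU --> G.
Proof.
move=> UUU UUF; pose K := [set p : lsc R X * R | UU [set G | G p.1 <= p.2%:E]].
have coneK : constraint_cone K.
  split.
  - by apply: filterS filterT => G _ /=; rewrite prev0.
  - move=> y y' c c' Kyc Kyc'; apply: filterS (filterI Kyc Kyc') => G [/= Gy Gy'].
    by rewrite (prev_additivity G) EFinD; exact: leeD.
  - move=> t y c; apply: filterS => G /= Gy.
    by rewrite (prev_homogeneous G) EFinM lee_wpmul2l ?lee_fin.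
have FK : dominated F K.
  move=> y c Kyc; rewrite leNgt; apply/negP => /UUF cy.
  have [G [/= Gc]] := filter_ex (filterI Kyc cy).
  by rewrite /prev_gt /= ltNge Gc.
have [G [FG GK]] := sandwich coneK FK; exists G => //.
apply: prev_cvg => h a ah; have [//|nah] := in_ultra_setVsetC (prev_gt h a) UUU.
have : K (h, a) by apply: filterS nah => G' /= /negP; rewrite -leNgt.
by move=> /GK; rewrite leNgt ah.
Qed.

Lemma dominators_neq0 F : dominators_set F !=set0.
Proof.
have [||G [FG _]] := @sandwich _ _ _ F [set (lsc_cst 0%:nng%R, 0%R)].
- split=> // [_ _ _ _ [-> ->] [-> ->]|c _ _ [-> ->]] /=.
    by rewrite lsc_add0 addr0.
  by rewrite mulr0; congr pair; apply: lscP => x /=; rewrite mule0.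
- by move=> _ _ [-> ->]; rewrite prev0.
- by exists G.
Qed.

Lemma dominators_compact F : compact (dominators_set F).
Proof.
rewrite compact_ultra => UU UUU UUF.
have [|G FG UUG] := @ultra_dominator F UU UUU; last by exists G.
by move=> h a ah; apply: filterS UUF => G FG; exact: lt_le_trans (FG h).
Qed.

Lemma dominators_saturated F : saturated (dominators_set F).
Proof.
by move=> G' [G FG /prev_spec_le GG'] h; apply: le_trans (GG' h).
Qed.

Definition dominators_fun F : smyth (prevision R Linear b X) :=
  Smyth (@dominators_neq0 F) (@dominators_compact F) (@dominators_saturated F).

(** If no neighborhood of [F] is sent into [box U], the dominators outside [U] of previsions near
    [F] generate a proper filter. A finer ultrafilter converges to a dominator of [F], hence to a
    point of the open set [U], yet contains the complement of [U]. *)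
Lemma dominators_cts : continuous dominators_fun.
Proof.
apply: cts_smyth => U oU; rewrite openE => F FU; apply: contrapT => nF.
pose EE := [set E : set (prevision R Linear b X) | exists2 V, nbhs F V &
  forall F' G, V F' -> dominators_set F' G -> ~ U G -> E G].
have EEF : ProperFilter EE.
  split.
    move=> [V FV VU]; apply: nF; apply: filterS FV => F' VF' G F'G.
    by apply: contrapT; exact: VU F'G.
  split.
  - by exists setT => //; exact: filterT.
  - move=> E E' [V FV VE] [V' FV' VE']; exists (V `&` V'); first exact: filterI.
    by move=> F' G [VF' V'F'] F'G UG; split; [exact: VE F'G UG|exact: VE' F'G UG].
  - move=> E E' EE' [V FV VE]; exists V => // F' G VF' F'G UG.
    by apply: EE'; exact: VE F'G UG.
have [UU [UUU EEUU]] := ultraFilterLemma EEF.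
have [|G FG UUG] := @ultra_dominator F UU UUU.
  move=> h a ah; apply: EEUU; exists (prev_gt h a).
    by apply: open_nbhs_nbhs; split => //; exact: open_prev_gt.
  by move=> F' G aF' F'G _; exact: lt_le_trans (F'G h).
have UUnU : UU (~` U) by apply: EEUU; exists setT => //; exact: filterT.
have UU_U : UU U by apply: UUG; apply: open_nbhs_nbhs; split => //; exact: FU.
by have [x []] := filter_ex (filterI UU_U UUnU).
Qed.

Definition dominators :
    continuousType (prevision R Superlinear b X) (smyth (prevision R Linear b X)) :=
  mkcts dominators_cts.

End dominators.

(** * The map [r]: minima over compact sets *)

Section smyth_inf.
Context {R : realType}.

(** Without a minimum, the sets [g > a], where [a] is an upper bound of some value of [g] on [Q],
    form a directed open cover of [Q]. One of them would contain [Q], including a point where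
    [g <= a]. *)
Lemma smyth_argmin {T : topologicalType} (g : lsc R T) (Q : smyth T) :
  exists2 x, smyth_set Q x & forall y, smyth_set Q y -> g x <= g y.
Proof.
apply: contrapT => nmin.
have Qlt x : smyth_set Q x -> exists2 y, smyth_set Q y & g y < g x.
  move=> Qx; apply: contrapT => ny; apply: nmin; exists x => // y Qy.
  by rewrite leNgt; apply/negP => yx; apply: ny; exists y.
pose D := [set [set x | a%:E < g x] | a in
  [set a : R | exists2 y, smyth_set Q y & g y <= a%:E]].
have QD x : smyth_set Q x -> exists2 a : R,
    (exists2 y, smyth_set Q y & g y <= a%:E) & a%:E < g x.
  move=> /Qlt[y Qy /lt_fin_between[a ya ax]]; exists a => //.
  by exists y => //; exact: ltW.
have /compact_directedP/(_ D) := @smyth_compact _ Q.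
case.
- by have [x /QD[a Qa _]] := smyth_neq0 Q; exists [set x | a%:E < g x], a.
- by move=> _ [a _ <-]; exact: lsc_open.
- move=> _ _ [a Qa <-] [c Qc <-]; have [ac|/ltW ca] := leP a c.
    exists [set x | a%:E < g x]; first by exists a.
    by move=> x [//|] /=; apply: le_lt_trans; rewrite lee_fin.
  exists [set x | c%:E < g x]; first by exists c.
  by move=> x [|//] /=; apply: le_lt_trans; rewrite lee_fin.
- by move=> x /QD[a Qa ax]; exists [set x | a%:E < g x] => //; exists a.
- move=> _ [a [y Qy ya] <-] /(_ _ Qy) /=.
  by rewrite ltNge ya.
Qed.

Context {b : normalization} {X : topologicalType}.
Implicit Types (Q : smyth (prevision R Linear b X)) (h : lsc R X).

Definition smyth_inf_val Q h := ereal_inf [set G h | G in smyth_set Q].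

Lemma smyth_inf_min Q h : is_min [set G h | G in smyth_set Q] (smyth_inf_val Q h).
Proof.
split; last exact: ereal_inf_lbound.
have [G QG Gmin] := smyth_argmin (prev_eval h) Q; exists G => //.
apply/le_anti/andP; split; last by apply: ereal_inf_lbound; exists G.
by apply: le_ereal_inf_tmp => _ [G' QG' <-]; exact: Gmin.
Qed.

Lemma smyth_inf_ge0 Q h : 0 <= smyth_inf_val Q h.
Proof. by have [[G _ <-] _] := smyth_inf_min Q h; exact: prev_ge0. Qed.

Lemma smyth_inf_le Q h G : smyth_set Q G -> smyth_inf_val Q h <= G h.
Proof. by move=> QG; apply: (smyth_inf_min Q h).2; exists G. Qed.

(** The converse holds because the infimum is attained. It turns equations for [r] into inclusions
    in open sets. *)
Lemma smyth_inf_gtP Q h (a : R) : a%:E < smyth_inf_val Q h <-> Q `<=` prev_gt h a.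
Proof.
split=> [aQ G QG|Qa]; first by rewrite /prev_gt /= (lt_le_trans aQ)// smyth_inf_le.
by have [[G QG <-] _] := smyth_inf_min Q h; exact: Qa.
Qed.

(** If all of [Q] exceeds [a] at the supremum of [D], the sets [prev_gt h a] with [h] in [D] form a
    directed open cover of [Q]; compactness selects one. *)
Lemma smyth_inf_scott Q : scott_continuous (smyth_inf_val Q).
Proof.
apply/scott_continuousP; split=> [h h' hh'|D m a dD Dm /smyth_inf_gtP Qa].
  have [[G QG <-] _] := smyth_inf_min Q h'.
  by apply: le_trans (smyth_inf_le h QG) _; exact: prev_le.
have /compact_directedP/(_ (prev_gt^~ a @` D)) := @smyth_compact _ Q.
case; first by have [h Dh] := dD.1; exists (prev_gt h a), h.
- by move=> _ [h _ <-]; exact: open_prev_gt.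
- move=> _ _ [h Dh <-] [h' Dh' <-]; have [h'' [Dh'' hh'' h'h'']] := dD.2 _ _ Dh Dh'.
  exists (prev_gt h'' a); first by exists h''.
  by move=> G [] /lt_le_trans; apply; exact: prev_le.
- move=> G /Qa /(((scott_continuousP _).1 (prev_scott G)).2 _ _ _ dD Dm)[h Dh ah].
  by exists (prev_gt h a) => //; exists h.
- by move=> _ [h Dh <-] /smyth_inf_gtP ?; exists h.
Qed.

Lemma smyth_inf_homogeneous Q : homogeneous (smyth_inf_val Q).
Proof.
apply: homogeneous_supscale => [||c h c0]; first exact: smyth_inf_ge0.
- by have [[G _ <-] _] := smyth_inf_min Q (lsc_cst 0%:nng%R); rewrite prev0.
- have [[G QG <-] _] := smyth_inf_min Q (lsc_scale c h).
  by rewrite (prev_homogeneous G) lee_wpmul2l ?lee_fin// smyth_inf_le.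
Qed.

Lemma smyth_inf_superlinear Q : superlinear (smyth_inf_val Q).
Proof.
move=> h h'; have [[G QG <-] _] := smyth_inf_min Q (lsc_add h h').
by rewrite (prev_additivity G) leeD// smyth_inf_le.
Qed.

End smyth_inf.

Lemma smyth_inf_normalization {R : realType} {b : normalization} {X : topologicalType}
  (Q : smyth (prevision R Linear b X)) :
  normalization_cond b (smyth_inf_val Q).
Proof.
case: b Q => //= Q h; last apply/le_anti/andP; (try split).
- have [[G QG <-] _] := smyth_inf_min Q h.
  exact: le_trans (smyth_inf_le _ QG) (prev_normalization G h).
- have [[G QG <-] _] := smyth_inf_min Q h.
  by rewrite -(prev_normalization G) smyth_inf_le.
- have [[G QG <-] _] := smyth_inf_min Q (lsc_add (lsc_cst 1%:nng%R) h).
  by rewrite (prev_normalization G) leeD2l// smyth_inf_le.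
Qed.

Section smyth_inf_prevision.
Context {R : realType} {b : normalization} {X : topologicalType}.
Implicit Types (Q : smyth (prevision R Linear b X)) (h : lsc R X).

Definition smyth_inf_fun Q : prevision R Superlinear b X :=
  @Prevision R Superlinear b X (smyth_inf_val Q)
    (@smyth_inf_ge0 _ _ _ Q)
    (@smyth_inf_scott _ _ _ Q) (@smyth_inf_homogeneous _ _ _ Q)
    (@smyth_inf_superlinear _ _ _ Q)
    (@smyth_inf_normalization _ _ _ Q).

Lemma smyth_inf_cts : continuous smyth_inf_fun.
Proof.
apply: cts_prevision => h a _.
rewrite (_ : _ @^-1` _ = box (prev_gt h a)); first exact/open_box/open_prev_gt.
by apply/seteqP; split=> Q /smyth_inf_gtP.
Qed.

Definition smyth_inf :
    continuousType (smyth (prevision R Linear b X)) (prevision R Superlinear b X) :=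
  mkcts smyth_inf_cts.

(** For finite [F h], the ray through [(h, F h)], taken as cone, yields a dominator of [F] whose
    value at [h] is at most [F h]. *)
Lemma smyth_inf_dominators (F : prevision R Superlinear b X) :
  smyth_inf (dominators F) = F.
Proof.
apply: previsionP => h; apply/le_anti/andP; split; last first.
  by apply: le_ereal_inf_tmp => _ [G FG <-]; exact: FG.
case Fh : (F h) => [v| |]; first last.
- by have := prev_ge0 F h; rewrite Fh.
- by rewrite leey.
have [||G [FG GK]] := @sandwich _ _ _ F
    [set p | exists t : {nonneg R}, p = (lsc_scale t h, (t%:num * v)%R)].
- split; first by exists 0%:nng%R; rewrite lsc_scale0//= mul0r.
    move=> _ _ _ _ [t [-> ->]] [t' [-> ->]]; exists (t%:num + t'%:num)%:nng%R.
    by rewrite lsc_scaleDl -mulrDl.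
  move=> c _ _ [t [-> ->]]; exists (c%:num * t%:num)%:nng%R.
  by rewrite lsc_scaleA mulrA.
- by move=> _ _ [t [-> ->]]; rewrite (prev_homogeneous F) Fh.
apply: le_trans (smyth_inf_le (Q := dominators F) h FG) (GK _ _ _).
by exists 1%:nng%R; rewrite lsc_scale1//= mul1r.
Qed.

(** Hence [retr_j] is the inclusion of linear into superlinear previsions. *)
Lemma smyth_inf_unit (G : prevision R Linear b X) h :
  smyth_inf (smyth_unit G) h = G h.
Proof.
apply: eq_fin_lt => a; apply: iff_trans (smyth_inf_gtP _ _ _) _.
exact: (smyth_unit_sub G (open_prev_gt _ _ h a)).
Qed.

End smyth_inf_prevision.

(** * The equations of a distributing retraction *)

Section retraction.
Context {R : realType} {b : normalization}.
Implicit Types X Y : topologicalType.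
Local Notation PL := (prevision R Linear b).
Local Notation PS := (prevision R Superlinear b).

Lemma smyth_inf_map X Y (f : continuousType X (PL Y)) (Q : smyth X) h (a : R) :
  a%:E < smyth_inf (smyth_map f Q) h <-> forall x, smyth_set Q x -> a%:E < f x h.
Proof.
apply: iff_trans (smyth_inf_gtP _ _ _) _.
exact: (smyth_map_sub f Q (open_prev_gt _ _ h a)).
Qed.

(** Lifts a linear dominator through the multiplication. The case [k = Linear] serves
    [retr_e_multT], the case [k = Superlinear] serves [retr_e_kleisli]. *)
Lemma sandwich_eval k X (F : PS (prevision R k b X)) (G : PL X) :
  (forall h, F (prev_eval h) <= G h) ->
  exists GG : PL (prevision R k b X),
    (forall g, F g <= GG g) /\ forall h, GG (prev_eval h) <= G h.
Proof.
move=> FG.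
(* [prev_eval] is only superlinear in [h] when [k] is [Superlinear], so that the
   constraints have to be closed downwards. *)
have [||GG [FGG GGK]] := @sandwich _ _ _ F
    [set p | exists2 h, (p.1 <= prev_eval h)%O & G h <= p.2%:E].
- split.
  + exists (lsc_cst 0%:nng%R); last by rewrite /= prev0.
    by apply/lsc_leP => F' /=; rewrite prev0.
  + move=> y y' c c' [h /= yh hc] [h' /= yh' hc']; exists (lsc_add h h').
      apply: le_trans (lsc_leD yh yh') _; apply/lsc_leP => F' /=.
      by case: k F' {F FG y y' yh yh'} => F';
        [rewrite (prev_additivity F')|exact: (prev_additivity F')].
    by rewrite (prev_additivity G) EFinD leeD.
  + move=> t y c [h /= /lsc_leP yh hc]; exists (lsc_scale t h).
      apply/lsc_leP => F' /=; rewrite (prev_homogeneous F').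
      by rewrite lee_wpmul2l ?lee_fin//; exact: yh.
    by rewrite (prev_homogeneous G) EFinM lee_wpmul2l ?lee_fin.
- move=> y c [h /= yh hc]; apply: le_trans hc; apply: le_trans (FG h).
  exact: prev_le.
exists GG; split=> // h; apply: le_fin_lt => a ah.
case Gh : (G h) => [v| |]; [|by rewrite leey|by have := prev_ge0 G h; rewrite Gh].
by apply/ltW/(lt_le_trans ah)/GGK; exists h; rewrite //= Gh.
Qed.

Lemma dominators_map X Y (f : continuousType X Y) (F : PS X) :
  dominators (Defs.prev_map f F) = smyth_map (Defs.prev_map f) (dominators F).
Proof.
apply: smythP; apply/seteqP; split=>
    [G' FG'|G' [_ [G FG <-] /prev_spec_le GG'] h]; last first.
  exact: le_trans (FG _) (GG' h).
(* These bounds yield a dominator [G] of [F] whose image under [f] lies below [G'], so that [G']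
   belongs to the upward closure. *)
have [||G [FG GK]] := @sandwich _ _ _ F
    [set p | exists2 h, p.1 = lsc_comp h f & G' h <= p.2%:E].
- split.
  + by exists (lsc_cst 0%:nng%R); [exact: lscP|rewrite /= prev0].
  + move=> _ _ c c' [h /= -> hc] [h' /= -> hc']; exists (lsc_add h h').
      exact: lscP.
    by rewrite (prev_additivity G') EFinD leeD.
  + move=> t _ c [h /= -> hc]; exists (lsc_scale t h); first exact: lscP.
    by rewrite (prev_homogeneous G') EFinM lee_wpmul2l ?lee_fin.
- by move=> _ c [h /= -> hc]; apply: le_trans hc; exact: FG'.
exists (Defs.prev_map f G); first by exists G.
apply/prev_spec_le => h; rewrite /=.
case G'h : (G' h) => [v| |]; [|by rewrite leey|by have := prev_ge0 G' h; rewrite G'h].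
by apply: GK; exists h; rewrite //= G'h.
Qed.

End retraction.

Theorem mainTheorem2 (R : realType) (b : normalization) :
  exists (r : forall X : topologicalType,
            continuousType (smyth (prevision R Linear b X))
                           (prevision R Superlinear b X))
         (s : forall X : topologicalType,
            continuousType (prevision R Superlinear b X)
                           (smyth (prevision R Linear b X))),
    [/\ forall (X : topologicalType) (Q : smyth (prevision R Linear b X))
          (h : lsc R X),
          is_min [set G h | G in smyth_set Q] (r X Q h),
        forall (X : topologicalType) (F : prevision R Superlinear b X),
          smyth_set (s X F) =
          [set G : prevision R Linear b X | forall h : lsc R X, F h <= G h] &
        distributing_retraction
          (S := smyth_monad) (T := prev_monad R Linear b)
          (U := prev_monad R Superlinear b) r s].
Proof.
exists (fun X => @smyth_inf R b X), (fun X => @dominators R b X).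
split=> [X Q h|//|]; first exact: smyth_inf_min.
split.
- move=> X Y f; apply/continuousEP => Q; apply: previsionP => h; apply: eq_fin_lt => a.
  apply: iff_trans (smyth_inf_map (Defs.prev_map f) Q h a) _.
  exact: iff_sym (smyth_inf_gtP Q (lsc_comp h f) a).
- by move=> X Y f; apply/continuousEP => F; exact: dominators_map.
- by move=> X; apply/continuousEP => F; exact: smyth_inf_dominators.
- move=> X; apply/continuousEP => x; apply: previsionP => h; apply: eq_fin_lt => a.
  apply: iff_trans (smyth_inf_map _ (smyth_unit x) h a) _.
  exact: (smyth_unit_sub x (lsc_open h a)).
(* Both sides exceed [a] at [h] exactly when every member of [QQ] is included in [prev_gt h a]. *)
- move=> X; apply/continuousEP => QQ; apply: previsionP => h; apply: eq_fin_lt => a.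
  apply: iff_trans (smyth_inf_gtP _ _ _) _; apply: iff_trans (smyth_mult_sub QQ _) _.
  apply: iff_sym; apply: iff_trans (smyth_inf_map _ QQ _ a) _.
  by split=> QQa Q /QQa /smyth_inf_gtP.
- move=> X; apply/continuousEP => Q; apply: previsionP => h; apply: eq_fin_lt => a.
  apply: iff_trans (smyth_inf_map _ Q h a) _.
  apply: iff_sym; apply: iff_trans (smyth_inf_gtP Q _ a) _.
  have evalE : lsc_comp (prev_eval h) (retr_j (S := smyth_monad)
      (T := prev_monad R Linear b) (U := prev_monad R Superlinear b)
      (fun X => @smyth_inf R b X) X) = prev_eval h.
    by apply: lscP => G; exact: smyth_inf_unit.
  by rewrite /prev_gt evalE.
- move=> X; apply/continuousEP => G; apply: smythP; apply/seteqP; split=> G'.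
    move=> GG'; exists G => //; apply/prev_spec_le => h.
    by rewrite -(smyth_inf_unit G h).
  by move=> [_ -> /prev_spec_le GG'] h; rewrite smyth_inf_unit.
- move=> X; apply/continuousEP => Q; apply: smythP; apply/seteqP; split=> G.
    (* The lifted [GG] dominates [smyth_inf Q] and its multiplication lies below [G]; the right-hand
       side is upward closed. *)
    move=> QG; have [|GG [QGG GGG]] := @sandwich_eval _ _ _ _ (smyth_inf Q) G.
      move=> h; apply: le_trans (QG h); apply: le_fin_lt => a /smyth_inf_gtP Qa.
      exact/ltW/(smyth_inf_map (@prev_mult R Linear b X) Q h a).
    exists (prev_mult GG); first by exists GG.
    exact/prev_spec_le.
  move=> [_ [GG QGG <-] /prev_spec_le GGG] h; apply: le_trans (GGG h).
  apply: le_trans (QGG (prev_eval h)); apply: le_fin_lt => a Qa.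
  apply/ltW/smyth_inf_gtP => HH QHH.
  exact: (smyth_inf_map (@prev_mult R Linear b X) Q h a).1 Qa _ QHH.
- move=> X f.
  (* Since [retr_j] is an inclusion, [f GG] consists of the linear dominators of
     [h |-> GG (prev_eval h)]. *)
  have fE GG h : prev_mult (retr_j (S := smyth_monad) (T := prev_monad R Linear b)
      (U := prev_monad R Superlinear b) (fun X => @smyth_inf R b X) _ GG) h =
      GG (@prev_eval R Superlinear b X h) by exact: smyth_inf_unit.
  (* As [r] after [s] is the identity, the minimum over [f GG] at [h] is [GG (prev_eval h)]; both
     sides exceed [a] when all these values with [GG] in [Q] do. *)
  have rfE Q h : smyth_inf (kleisli (S := smyth_monad) f Q) h =
      smyth_inf Q (@prev_eval R Superlinear b X h).
    apply: eq_fin_lt => a; apply: iff_trans (smyth_inf_gtP _ _ _) _.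
    apply: iff_trans (smyth_mult_sub _ _) _.
    apply: iff_trans (smyth_map_sub _ _ (open_box (open_prev_gt _ _ _ _))) _.
    apply: iff_sym; apply: iff_trans (smyth_inf_gtP _ _ _) _.
    split=> Qa GG /Qa; rewrite /prev_gt /= -fE -[prev_mult _]smyth_inf_dominators.
      by move/smyth_inf_gtP.
    by move=> ?; exact/smyth_inf_gtP.
  apply/continuousEP => Q; apply: smythP; apply/seteqP; split=> G.
    move=> QG; have [|GG [QGG GGG]] := @sandwich_eval _ _ _ _ (smyth_inf Q) G.
      by move=> h; rewrite -rfE; exact: QG.
    exists (f GG); last by move=> h; rewrite fE.
    by apply: sub_up; exists GG.
  move=> [P [_ [GG QGG <-] fP] PG] h; rewrite rfE; apply: le_trans (QGG _) _.
  rewrite -fE; apply: le_fin_lt => a aGG; apply/ltW.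
  (* Being above [f GG] in the specialization preordering, [P] lies in every open [box] containing
     [f GG], which transfers strict lower bounds to [G]. *)
  apply: (fP (box (prev_gt h a))) PG; first exact/open_box/open_prev_gt.
  by move=> G' /(_ h); apply: lt_le_trans.
Qed.
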